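(* Let $T_n=((a_{i-j,n}))_{i,j=1}^n$ be a random Toeplitz matrix whose input entries satisfy the pair-correlation assumption (A) stated in the context, and put $A_{n,1}=n^{-1/2}T_n$. Let $m\ge 1$; for $i=1,\ldots,m$ let $A_{n,1}^{(i)}$ be independent copies of $A_{n,1}$, and let $A_{n,2}^{(i)}=D_n^{(i)}=((d^{(i)}_{k-l}))_{k,l=1}^n$ be deterministic Toeplitz matrices, where for each $i$ the sequence $\{d^{(i)}_k; k\in\mathbb{Z}\}$ of complex numbers (not depending on $n$) satisfies $\sum_{k\in\mathbb{Z}}|d^{(i)}_k|<\infty$. Let $P_n$ be the $n\times n$ backward identity permutation matrix. Then, as $n\to\infty$, $\{P_n, A_{n,j}^{(i)}; 1\le j\le 2, 1\le i\le m\}$ converge jointly in $*$-distribution. In particular, $\{P_n, n^{-1/2}T_n, D_n\}$ converge jointly in $*$-distribution, where $D_n$ is a deterministic Toeplitz matrix with absolutely summable input sequence.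
   Context: Assumption (A): for each $n$, $\{a_{j,n}=x_{j,n}+\mathrm{i}y_{j,n}; j\in\mathbb{Z}\}$ are complex random variables ($x_{j,n},y_{j,n}$ real) with $\mathbf{E}(a_{j,n})=0$; the vectors $(x_{j,n},x_{-j,n},y_{j,n},y_{-j,n})$, $j\ge 0$, are independent across $j$; and there are constants $\sigma_x^2,\sigma_y^2,\rho_1,\ldots,\rho_6$ (not depending on $j,n$) with: (i) $\mathbf{E}[x_{j,n}^2]=\sigma_x^2$, $\mathbf{E}[y_{j,n}^2]=\sigma_y^2$ for all $j\in\mathbb{Z}$; (ii) for all $j\ge1$: $\mathbf{E}[x_{j,n}y_{j,n}]=\rho_1$, $\mathbf{E}[x_{j,n}x_{-j,n}]=\rho_2$, $\mathbf{E}[x_{j,n}y_{-j,n}]=\rho_3$, $\mathbf{E}[x_{-j,n}y_{j,n}]=\rho_4$, $\mathbf{E}[y_{j,n}y_{-j,n}]=\rho_5$, $\mathbf{E}[x_{-j,n}y_{-j,n}]=\rho_6$; (iii) $\sup_{j,n}\{\mathbf{E}|x_{j,n}|^k,\mathbf{E}|y_{j,n}|^k\}\le c_k<\infty$ for all $k\ge1$. The backward identity permutation matrix $P_n$ has $(i,j)$ entry $1$ if $i+j=n+1$ and $0$ otherwise. For an $n\times n$ random matrix $B$ with entries having all moments finite, $\varphi_n(B)=\frac1n\mathbf{E}[\mathrm{Tr}(B)]$. For a matrix $B$, $B^1=B$ and $B^*$ is the conjugate transpose. A finite family of sequences of $n\times n$ matrices $\{A_{i,n}\}_{i\in I}$ converges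 jointly in $*$-distribution if for every $k\ge1$, all $i_1,\ldots,i_k\in I$ and all $\epsilon_1,\ldots,\epsilon_k\in\{1,*\}$ the limit $\lim_{n\to\infty}\varphi_n(A_{i_1,n}^{\epsilon_1}\cdots A_{i_k,n}^{\epsilon_k})$ exists (and is finite); these limits then define the $*$-moments of limit elements in a $*$-probability space. *)

(* Defs.v *)
From HB Require Import structures.
From mathcomp Require Import all_boot all_order all_algebra finmap.
From mathcomp Require Import complex.
From mathcomp Require Import all_classical all_reals all_analysis.

Set Implicit Arguments.
Unset Strict Implicit.
Unset Printing Implicit Defensive.

Import Order.TTheory GRing.Theory Num.Theory numFieldNormedType.Exports.

Local Open Scope classical_set_scope.
Local Open Scope ring_scope.
Local Open Scope complex_scope.

Section matrices.
Variable R : realType.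

Definition toeplitz (a : int -> R[i]) n : 'M[R[i]]_n :=
  \matrix_(k < n, l < n) a ((k : nat)%:Z - (l : nat)%:Z).

(* 1-based indices are the successors of the ordinals. *)
Definition backward_identity n : 'M[R[i]]_n :=
  \matrix_(k < n, l < n) (k.+1 + l.+1 == n.+1)%N%:R.

Definition starpow n (star : bool) (M : 'M[R[i]]_n) : 'M[R[i]]_n :=
  if star then map_mx Num.conj M^T else M.

Definition absolutely_summable (d : int -> R[i]) : Prop :=
  (\esum_(k in [set: int]) (Normc.normc (d k))%:E < +oo)%E.

(* Real coordinates of a complex matrix; the product sigma-algebra of the
   codomain is the Borel sigma-algebra of the space of complex matrices. *)
Definition mxcoord n (M : 'M[R[i]]_n) : n.-tuple (n.-tuple (R * R)%type) :=
  [tuple [tuple (complex.Re (M k l), complex.Im (M k l)) | l < n] | k < n].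
End matrices.
Arguments backward_identity {R} n.

Section probability_notions.
Context {R : realType} {d : measure_display} {Omega : measurableType d}.
Variable P : probability Omega R.

(* Meaningful when the real and imaginary parts of Z are integrable: fine
   sends infinite values to 0. *)
Definition cexpectation (Z : Omega -> R[i]) : R[i] :=
  fine 'E_P[fun w => complex.Re (Z w)]%E +i*
  fine 'E_P[fun w => complex.Im (Z w)]%E.

Definition mutually_independent (I : choiceType) (dT : measure_display)
    (T : measurableType dT) (X : I -> Omega -> T) : Prop :=
  forall (J : {fset I}) (B : I -> set T), (forall i, measurable (B i)) ->
    P (\bigcap_(i in [set` J]) X i @^-1` B i) =
    (\prod_(i <- J) P (X i @^-1` B i))%E.

Definition identically_distributed (dT : measure_display)
    (T : measurableType dT) (X Y : Omega -> T) : Prop :=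
  forall B : set T, measurable B -> P (X @^-1` B) = P (Y @^-1` B).

Definition random_matrix n (X : Omega -> 'M[R[i]]_n) : Prop :=
  measurable_fun [set: Omega] (fun w => mxcoord (X w)).

Definition independent_copies n (I : choiceType)
    (X : I -> Omega -> 'M[R[i]]_n) (Y : Omega -> 'M[R[i]]_n) : Prop :=
  [/\ forall i, random_matrix (X i),
      mutually_independent (fun i w => mxcoord (X i w)) &
      forall i, identically_distributed
        (fun w => mxcoord (X i w)) (fun w => mxcoord (Y w))].

Definition phi n (B : Omega -> 'M[R[i]]_n) : R[i] :=
  n%:R^-1 * cexpectation (fun w => \tr (B w)).

Definition converge_in_star_distribution (I : finType)
    (A : forall n, I -> Omega -> 'M[R[i]]_n) : Prop :=
  forall (k : nat) (i : 'I_k -> I) (eps : 'I_k -> bool), (0 < k)%N ->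
    cvgn ((fun n => phi (fun w => \prod_(s < k) starpow (eps s) (A n (i s) w)))
          : nat -> R[i]^o).

Record pair_correlated (x y : nat -> int -> {RV P >-> R})
    (sigmax sigmay rho1 rho2 rho3 rho4 rho5 rho6 : R) : Prop := {
  pc_mean : forall n j, cexpectation (fun w => x n j w +i* y n j w) = 0 ;
  pc_indep : forall n, mutually_independent (fun (j : nat) w =>
    (x n j%:Z w, x n (- j%:Z) w, y n j%:Z w, y n (- j%:Z) w)) ;
  pc_varx : forall n j,
    ('E_P[fun w => (x n j w ^+ 2)%R] = (sigmax ^+ 2)%R%:E)%E ;
  pc_vary : forall n j,
    ('E_P[fun w => (y n j w ^+ 2)%R] = (sigmay ^+ 2)%R%:E)%E ;
  pc_rho1 : forall n (j : int), 1 <= j ->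
    ('E_P[fun w => (x n j w * y n j w)%R] = rho1%:E)%E ;
  pc_rho2 : forall n (j : int), 1 <= j ->
    ('E_P[fun w => (x n j w * x n (- j) w)%R] = rho2%:E)%E ;
  pc_rho3 : forall n (j : int), 1 <= j ->
    ('E_P[fun w => (x n j w * y n (- j) w)%R] = rho3%:E)%E ;
  pc_rho4 : forall n (j : int), 1 <= j ->
    ('E_P[fun w => (x n (- j) w * y n j w)%R] = rho4%:E)%E ;
  pc_rho5 : forall n (j : int), 1 <= j ->
    ('E_P[fun w => (y n j w * y n (- j) w)%R] = rho5%:E)%E ;
  pc_rho6 : forall n (j : int), 1 <= j ->
    ('E_P[fun w => (x n (- j) w * y n (- j) w)%R] = rho6%:E)%E ;
  pc_moments : forall k, (0 < k)%N -> exists c : R, forall n j,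
    ('E_P[fun w => (`|x n j w| ^+ k)%R] <= c%:E)%E /\
    ('E_P[fun w => (`|y n j w| ^+ k)%R] <= c%:E)%E
}.

Definition scaled_toeplitz (x y : nat -> int -> {RV P >-> R}) n (w : Omega) :
    'M[R[i]]_n :=
  (Num.sqrt n%:R)^-1%:C *: toeplitz (fun j => x n j w +i* y n j w) n.
End probability_notions.

Definition joint_family (R : realType) (Omega : Type) n (I : finType)
    (A : I -> Omega -> 'M[R[i]]_n) (D : I -> 'M[R[i]]_n)
    (e : unit + (I + I)) : Omega -> 'M[R[i]]_n :=
  match e with
  | inl _ => fun=> backward_identity n
  | inr (inl i) => A i
  | inr (inr i) => fun=> D i
  end.

(* Main.v *)
Require Import Defs.
From HB Require Import structures.
From mathcomp Require Import all_boot all_order all_algebra finmap.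
From mathcomp Require Import complex.
From mathcomp Require Import all_classical all_reals all_analysis.
From mathcomp Require Import measurable_realfun ring lra zify.

(** The proof is the moment method, organised so that only the existence of the
    limits has to be established.

    A word in the matrices is a product of letters. Every letter has entries of
    the form [w (k - l)] or, for the backward identity, [w (n - 1 - k - l)], with
    [w] deterministic and summable, or equal to the random input. The trace of
    the product is therefore a sum over closed walks [k_0, ..., k_K = k_0] in
    [[0, n)], weighted by functions of the offsets of their steps
    ([trace_prod]). Taking expectations, the random letters contribute a number
    that depends on their offsets only: the copies are independent, and so are
    the blocks [(a_j, a_-j)] of each copy, so this number is a product over the
    classes of letters with the same copy and the same absolute value of the
    offset ([matched_moment], [copies_moment]). It vanishes when some class is a
    singleton, because the input is centred; it is bounded; and when all classes
    are pairs of nonzero offsets it depends on the pairing and on the signs only,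
    by the covariance assumptions.

    Deterministic weights are decomposed into point masses, one letter at a time,
    by dominated convergence for series ([tannery], [walk_sum_partial]). It then
    remains to treat words whose deterministic letters are partial shifts and
    reflections. Such a walk is determined by its starting point and by the
    offsets of the [p] random letters ([count_closed_walks]). Splitting the
    offsets according to their partition into classes, a partition with [r]
    classes contributes [O(n ^ (r + 1))] terms, against a normalisation
    [n ^ (1 + p / 2)]. As no class is a singleton, only pairings survive
    ([labelling_sum_cauchy]).

    For a pairing, up to a negligible error, the contribution is a constant times
    the proportion of points of the box [[0, n) ^ (p / 2 + 1)] that satisfy a
    system of affine inequalities with integer coefficients: the walk stays in
    [[0, n)] and closes up. Such a proportion converges. Indeed the box of side
    [n * m] is obtained from the box of side [n] by refining each point into a
    cell, and the inequalities have the same truth value on a cell and at its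
    corner unless the cell lies near one of the bounding hyperplanes, so that the
    proportions at [n] and at [n * m] differ by [O(1 / n)]. Comparing [n] and [m]
    through [n * m] shows that the proportions form a Cauchy sequence
    ([lattice_density]); volumes of polytopes are never mentioned. *)

Set Implicit Arguments.
Unset Strict Implicit.
Unset Printing Implicit Defensive.

Import Order.TTheory GRing.Theory Num.Theory numFieldNormedType.Exports.

Local Open Scope classical_set_scope.
Local Open Scope ring_scope.
Local Open Scope complex_scope.

(** * Moduli and Cauchy sequences of complex numbers *)

Notation cabs := (@Normc.normc _).

Section modulus.
Variable R : realType.
Implicit Types z : R[i].

Lemma cabs_ge0 z : 0 <= cabs z.
Proof. by case: z => a b; rewrite sqrtr_ge0. Qed.

Lemma cabs_norm z : `|z| = (cabs z)%:C.
Proof. by case: z => a b; rewrite normc_def. Qed.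

Lemma cabsM z1 z2 : cabs (z1 * z2) = cabs z1 * cabs z2.
Proof. exact: Normc.normcM. Qed.

Lemma cabsD z1 z2 : cabs (z1 + z2) <= cabs z1 + cabs z2.
Proof. exact: le_normcD. Qed.

Lemma cabsN z : cabs (- z) = cabs z.
Proof. exact: normcN. Qed.

Lemma cabsB z1 z2 : cabs (z1 - z2) <= cabs z1 + cabs z2.
Proof. by rewrite -(cabsN z2) cabsD. Qed.

Lemma cabs0 : cabs (0 : R[i]) = 0.
Proof. exact: Normc.normc0. Qed.

Lemma cabs1 : cabs (1 : R[i]) = 1.
Proof. exact: Normc.normc1. Qed.

Lemma cabs_real (x : R) : cabs x%:C = `|x|.
Proof. by rewrite /= expr0n /= addr0 sqrtr_sqr. Qed.

Lemma cabs_nat n : cabs (n%:R : R[i]) = n%:R.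
Proof. by rewrite -(rmorph_nat (real_complex R)) cabs_real normr_nat. Qed.

Lemma cabsV z : cabs z^-1 = (cabs z)^-1.
Proof. exact: Normc.normcV. Qed.

Lemma cabsX z k : cabs (z ^+ k) = cabs z ^+ k.
Proof. by elim: k => [|k IH]; rewrite ?cabs1 // !exprS cabsM IH. Qed.

Lemma cabs_sum (T : Type) (r : seq T) (Q : pred T) (F : T -> R[i]) :
  cabs (\sum_(t <- r | Q t) F t) <= \sum_(t <- r | Q t) cabs (F t).
Proof.
elim/big_ind2: _ => [|a b c e ab ce|//]; first by rewrite cabs0.
exact: le_trans (cabsD _ _) (lerD ab ce).
Qed.

Lemma cabs_prod (T : Type) (r : seq T) (Q : pred T) (F : T -> R[i]) :
  cabs (\prod_(t <- r | Q t) F t) = \prod_(t <- r | Q t) cabs (F t).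
Proof. exact: (big_morph _ cabsM cabs1). Qed.

Lemma cabs_sum_indicator n (g : 'I_n -> bool) :
  cabs (\sum_(b < n) (g b)%:R : R[i]) <= n%:R.
Proof.
apply: le_trans (cabs_sum _ _ _) _.
rewrite -[leRHS]mulr1 mulr_natl -[X in _ *+ X]card_ord -sumr_const.
by apply: ler_sum => b _; case: (g b); rewrite ?cabs1 ?cabs0.
Qed.

Lemma cabs_conj z : cabs (Num.conj z) = cabs z.
Proof. by case: z => a b; rewrite /= sqrrN. Qed.

Lemma Re_le_cabs z : `|complex.Re z| <= cabs z.
Proof. by have := normc_ge_Re z; rewrite cabs_norm lecR. Qed.

Lemma Im_le_cabs z : `|complex.Im z| <= cabs z.
Proof. by case: z => a b /=; rewrite -sqrtr_sqr ler_wsqrtr// lerDr sqr_ge0. Qed.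

Lemma cabs_le_ReIm z : cabs z <= `|complex.Re z| + `|complex.Im z|.
Proof.
case: z => a b /=.
have h : 0 <= `|a| + `|b| by rewrite addr_ge0.
rewrite -(ger0_norm h) -sqrtr_sqr ler_wsqrtr//.
rewrite sqrrD !real_normK ?num_real// lerD2r lerDl.
by rewrite pmulrn_lge0 // mulr_ge0.
Qed.

End modulus.

Section cauchy.
Variable R : realType.

(** Convergence is proved in this form throughout, because nothing has to be
    said about the value of the limit. *)
Definition cauchy_sequence (u : nat -> R[i]) : Prop :=
  forall e : R, 0 < e ->
  exists N, forall m n, (N <= m)%N -> (N <= n)%N -> cabs (u m - u n) <= e.

Lemma cauchy_cst z : cauchy_sequence (fun _ => z).
Proof. by move=> e e0; exists 0 => m n _ _; rewrite subrr cabs0 ltW. Qed.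

Lemma cauchyD u v : cauchy_sequence u -> cauchy_sequence v ->
  cauchy_sequence (fun n => u n + v n).
Proof.
move=> hu hv e e0; have e2 : 0 < e / 2 by lra.
have [N1 h1] := hu _ e2; have [N2 h2] := hv _ e2.
exists (maxn N1 N2) => m n; rewrite !geq_max => /andP[m1 m2] /andP[n1 n2].
rewrite opprD addrACA (le_trans (cabsD _ _))//.
by have := h1 _ _ m1 n1; have := h2 _ _ m2 n2; lra.
Qed.

Lemma cauchyZ z u : cauchy_sequence u -> cauchy_sequence (fun n => z * u n).
Proof.
move=> hu e e0; have z0 := cabs_ge0 z.
have e2 : 0 < e / (cabs z + 1) by rewrite divr_gt0 // ltr_wpDl.
have [N h] := hu _ e2; exists N => m n Nm Nn.
rewrite -mulrBr cabsM (le_trans (ler_wpM2l z0 (h _ _ Nm Nn)))//.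
by rewrite mulrCA ler_piMr ?(ltW e0)// ler_pdivrMr ?mul1r ?lerDl// ltr_wpDl.
Qed.

Lemma cauchy_sum (T : Type) (r : seq T) (u : T -> nat -> R[i]) :
  (forall t, cauchy_sequence (u t)) ->
  cauchy_sequence (fun n => \sum_(t <- r) u t n).
Proof.
move=> hu; elim: r => [|t r IH].
  by under eq_fun do rewrite big_nil; exact: cauchy_cst.
by under eq_fun do rewrite big_cons; exact: cauchyD.
Qed.

(** A uniform limit of Cauchy sequences is Cauchy. It is used to truncate the
    summable weights, and to discard terms that tend to zero. *)
Lemma cauchy_approx u :
  (forall e : R, 0 < e -> exists v, cauchy_sequence v /\
    exists N, forall n, (N <= n)%N -> cabs (u n - v n) <= e) ->
  cauchy_sequence u.
Proof.
move=> hu e e0; have e3 : 0 < e / 3 by lra.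
have [v [/(_ _ e3)[N1 h1] [N2 h2]]] := hu _ e3.
exists (maxn N1 N2) => m n; rewrite !geq_max => /andP[m1 m2] /andP[n1 n2].
have -> : u m - u n = (u m - v m) + (v m - v n) - (u n - v n) by ring.
have := h1 _ _ m1 n1; have := h2 _ m2; have := h2 _ n2.
have := cabsB (u m - v m + (v m - v n)) (u n - v n).
have := cabsD (u m - v m) (v m - v n); lra.
Qed.

Lemma inv_small (e : R) : 0 < e -> exists N, (0 < N)%N /\
  forall n, (N <= n)%N -> n%:R^-1 <= e.
Proof.
move=> e0; exists (Num.truncn e^-1).+1; split=> // n hn.
have n0 : 0 < n%:R :> R by rewrite ltr0n (leq_trans _ hn).
rewrite -[e]invrK lef_pV2 ?posrE ?invr_gt0//.
rewrite (le_trans (ltW (truncnS_gt _)))// ler_nat //.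
Qed.

Lemma cauchy_eventually_close u v (C : R) : cauchy_sequence v ->
  (forall n, (0 < n)%N -> cabs (u n - v n) <= C / Num.sqrt n%:R) ->
  cauchy_sequence u.
Proof.
move=> hv huv; apply: cauchy_approx => e e0; exists v; split=> //.
have C0 : 0 < `|C| + 1 by rewrite ltr_wpDl.
have q0 : 0 < (e / (`|C| + 1)) ^+ 2 by rewrite exprn_gt0// divr_gt0.
have [N [N0 hN]] := inv_small q0; exists N => n Nn.
have n0 : (0 < n)%N by exact: leq_trans Nn.
apply: le_trans (huv _ n0) _.
have s0 : 0 < Num.sqrt n%:R :> R by rewrite sqrtr_gt0 ltr0n.
have : (Num.sqrt n%:R)^-1 <= e / (`|C| + 1).
  rewrite -(@ler_pXn2r _ 2) ?nnegrE ?invr_ge0 ?(ltW s0)//; last first.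
    by rewrite divr_ge0 ?(ltW e0) ?(ltW C0).
  by rewrite exprVn sqr_sqrtr ?ler0n// hN.
rewrite ler_pdivlMr// => h; apply: le_trans h.
rewrite mulrC ler_wpM2l ?invr_ge0 ?(ltW s0)//.
by have := ler_norm C; lra.
Qed.

(** A scale-comparison criterion: passing from [n] to any multiple [n * m]
    changes the value by [O(1/n)], so two large indices are compared through
    their product. *)
Lemma cauchy_of_multiples u (C : R) (n0 : nat) :
  (forall n m, (n0 <= n)%N -> (0 < n)%N -> (0 < m)%N ->
     cabs (u (n * m)%N - u n) <= C / n%:R) ->
  cauchy_sequence u.
Proof.
move=> hu e e0.
have C0 : 0 < `|C| + 1 by rewrite ltr_wpDl.
have q0 : 0 < e / 2 / (`|C| + 1) by rewrite divr_gt0// divr_gt0.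
have [N [N0 hN]] := inv_small q0.
have H n : (maxn N n0 <= n)%N -> C / n%:R <= e / 2.
  rewrite geq_max => /andP[Nn _].
  have n1 : 0 <= n%:R^-1 :> R by rewrite invr_ge0.
  have := hN _ Nn; rewrite ler_pdivlMr// => h; apply: le_trans h.
  by rewrite mulrC ler_wpM2l//; have := ler_norm C; lra.
exists (maxn N n0) => m n Nm Nn.
have [m1 n1] : (0 < m /\ 0 < n)%N by lia.
have -> : u m - u n = (u (n * m)%N - u n) - (u (m * n)%N - u m).
  by rewrite [(m * n)%N]mulnC; ring.
have h1 := hu n m (leq_trans (leq_maxr N n0) Nn) n1 m1.
have h2 := hu m n (leq_trans (leq_maxr N n0) Nm) m1 n1.
have := H _ Nm; have := H _ Nn.
by have := cabsB (u (n * m)%N - u n) (u (m * n)%N - u m); lra.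
Qed.

Lemma eq_cauchy u v : (forall n, (0 < n)%N -> u n = v n) ->
  cauchy_sequence u -> cauchy_sequence v.
Proof.
move=> uv hu e e0; have [N h] := hu _ e0; exists N.+1 => m n Nm Nn.
by rewrite -!uv ?h// ?(leq_trans _ Nm) ?(leq_trans _ Nn)// ltnW.
Qed.
End cauchy.

(** * Density of lattice points under affine constraints *)

Section lattice.

(** A condition that fixes one coordinate of a point of the box [[0, n)^J]
    in terms of the others costs a factor [n]. *)
Lemma card_determined (J : finType) (j : J) n (A : {set {ffun J -> 'I_n}}) :
  {in A &, forall u u' : {ffun J -> 'I_n},
     (forall x, x != j -> u x = u' x) -> u = u'} ->
  (#|A| * n <= n ^ #|J|)%N.
Proof.
move=> hA.
pose res (u : {ffun J -> 'I_n}) : {ffun {x | x != j} -> 'I_n} :=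
  [ffun x => u (val x)].
have /card_in_imset <- : {in A &, injective res}.
  move=> u u' uA u'A /ffunP e; apply: hA => // x xj.
  by have := e (exist _ x xj); rewrite !ffunE.
apply: (@leq_trans (n ^ #|J|.-1 * n)%N); last first.
  by rewrite -expnSr prednK//; apply/card_gt0P; exists j.
rewrite leq_mul2r; apply/orP; right.
apply: leq_trans (max_card _) _.
by rewrite card_ffun card_ord card_sig cardC1.
Qed.

Lemma card_bigcup_le (T Q : finType) (A : Q -> {set T}) :
  (#|(\bigcup_q A q)%SET| <= \sum_q #|A q|)%N.
Proof.
apply: (big_ind2 (fun (X : {set T}) k => (#|X| <= k)%N)).
- by rewrite cards0.
- move=> X k Y l hX hY.
  by apply: leq_trans (leq_card_setU X Y) _; rewrite leq_add.
- by [].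
Qed.

(** Integer affine forms in the coordinates and in the side [n] of the box; the
    dependence on [n] comes from the backward identity, which maps [k] to
    [n - 1 - k]. *)
Definition affine_form (J : Type) (L : nat -> (J -> nat) -> int) : Prop :=
  exists (s : seq (int * J)) (c e : int), forall n u,
    L n u = \sum_(t <- s) t.1 * (u t.2)%:Z + c + e * n%:Z.

Lemma affine_var (J : Type) (j : J) :
  affine_form (fun _ (u : J -> nat) => (u j)%:Z).
Proof. by exists [:: (1, j)], 0, 0 => n u; rewrite big_seq1 /= mul1r mul0r !addr0. Qed.

Lemma affine_cst (J : Type) (c : int) : affine_form (fun _ (_ : J -> nat) => c).
Proof. by exists [::], c, 0 => n u; rewrite big_nil mul0r addr0 add0r. Qed.

Lemma affine_size (J : Type) : affine_form (fun n (_ : J -> nat) => n%:Z).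
Proof. by exists [::], 0, 1 => n u; rewrite big_nil mul1r !add0r. Qed.

Lemma affineD (J : Type) (L1 L2 : nat -> (J -> nat) -> int) :
  affine_form L1 -> affine_form L2 -> affine_form (fun n u => L1 n u + L2 n u).
Proof.
move=> [s1 [c1 [e1 h1]]] [s2 [c2 [e2 h2]]].
by exists (s1 ++ s2), (c1 + c2), (e1 + e2) => n u; rewrite h1 h2 big_cat /=; ring.
Qed.

Lemma affineN (J : Type) (L : nat -> (J -> nat) -> int) :
  affine_form L -> affine_form (fun n u => - L n u).
Proof.
move=> [s [c [e h]]]; exists [seq (- t.1, t.2) | t <- s], (- c), (- e) => n u.
rewrite h big_map /= !opprD mulNr -sumrN.
by congr (_ + _ + _); apply: eq_bigr => t _; rewrite mulNr.
Qed.

Lemma affine_coefficients (J : finType) (L : nat -> (J -> nat) -> int) :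
  affine_form L -> exists (l : {ffun J -> int}) (c e : int), forall n u,
    L n u = \sum_j l j * (u j)%:Z + c + e * n%:Z.
Proof.
move=> [s [c [e h]]].
exists [ffun j => \sum_(t <- s | t.2 == j) t.1], c, e => n u; rewrite h.
congr (_ + _ + _); rewrite (partition_big snd predT)//=; apply: eq_bigr => j _.
by rewrite ffunE mulr_suml; apply: eq_bigr => t /eqP ->.
Qed.

Lemma digits_lt n m (p : 'I_n * 'I_m) : (p.1 * m + p.2 < n * m)%N.
Proof. by case: p => [[a ha] [b hb]] /=; nia. Qed.

(** Each cell of the box of side [n] is refined into [m ^ #|J|] points of the
    box of side [n * m]. *)
Definition digits (J : finType) n m
    (p : {ffun J -> 'I_n} * {ffun J -> 'I_m}) : {ffun J -> 'I_(n * m)} :=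
  [ffun j => Ordinal (digits_lt (p.1 j, p.2 j))].

Lemma digits_bij (J : finType) n m : bijective (@digits J n m).
Proof.
apply: inj_card_bij; last first.
  by rewrite card_prod !card_ffun !card_ord expnMn.
move=> [u r] [u' r'] /ffunP e.
have key j : u j = u' j /\ r j = r' j.
  have := congr1 val (e j); rewrite !ffunE /= => h.
  have m0 : (0 < m)%N by case: (r j) => ? /=; exact: leq_trans.
  split; apply: val_inj => /=.
    by have := congr1 (divn^~ m) h; rewrite !divnMDl// !divn_small// !addn0.
  by have := congr1 (modn^~ m) h; rewrite !modnMDl !modn_small.
by congr (_, _); apply/ffunP => j; case: (key j).
Qed.

(** Multiplying the leading part [q] of a form by [m], and perturbing by at most
    [m * B], keeps the sign as soon as [q] is larger than [B]. *)
Lemma same_sign (q r c B m : int) : 0 < m ->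
  `|c| <= B -> `|r + c| <= m * B -> B < `|q| ->
  (0 <= m * q + r + c) = (0 <= q + c).
Proof. by move=> *; nia. Qed.
End lattice.

Section lattice_density.
Variable R : realType.

(** Lattice points of the box in dilating cells: the density is unchanged by
    refining each cell, except in the cells close to one of the hyperplanes. There are
    [O(n ^ (#|J| - 1))] of these, so the densities at [n] and [n * m] differ by
    [O(1/n)]. This replaces the identification of the limit as the volume of a
    polytope. *)
Lemma lattice_density (J I : finType) (L : I -> nat -> (J -> nat) -> int)
    (g : {ffun I -> bool} -> bool) : (forall i, affine_form (L i)) ->
  cauchy_sequence (fun n => (n%:R^-1) ^+ #|J| *
    \sum_(u : {ffun J -> 'I_n})
       (g [ffun i => 0 <= L i n (fun j => u j : nat)])%:R : R[i]).
Proof.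
move=> hL.
have {}hL i : exists t : {ffun J -> int} * int * int, forall n u,
    L i n u = \sum_j t.1.1 j * (u j)%:Z + t.1.2 + t.2 * n%:Z.
  by have [l [c [e h]]] := affine_coefficients (hL i); exists (l, c, e).
have [t {}hL] := boolp.choice hL.
pose l i := (t i).1.1; pose c i := (t i).1.2; pose e i := (t i).2.
pose Bi i : nat := (\sum_j `|l i j| + `|c i|)%N.
pose B := (\sum_i Bi i)%N.
have cB i : `|c i| <= (Bi i)%:Z.
  by rewrite /Bi; move: (\sum_j _)%N => X; lia.
have BiB i : (Bi i <= B)%N by rewrite /B (bigD1 i)//= leq_addr.
pose q i n (u : {ffun J -> 'I_n}) : int := \sum_j l i j * (u j)%:Z + e i * n%:Z.
(* The slabs where the leading part of a form takes one of the values
   [- B, ..., B]; a form without variables has no slab, and its sign is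
   constant once [n] exceeds [B]. *)
pose A n (i : I) (b : 'I_(2 * B).+1) : {set {ffun J -> 'I_n}} :=
  [set u | [exists j, l i j != 0] && (q i n u == b%:Z - B%:Z)]%SET.
have cardA n i b : (#|A n i b| * n <= n ^ #|J|)%N.
  have [/existsP[j lj]|/negbTE h] := boolP [exists j, l i j != 0]; last first.
    suff -> : A n i b = finset.set0 by rewrite cards0.
    by apply/setP => u; rewrite !inE h.
  apply: (@card_determined _ j) => u u'; rewrite !inE => /andP[_ /eqP hu] /andP[_ /eqP hu'] h.
  apply/ffunP => x; have [->|] := eqVneq x j; last exact: h.
  have : q i n u = q i n u' by rewrite hu hu'.
  rewrite /q => /addIr; rewrite (bigD1 j)//= [RHS](bigD1 j)//=.
  rewrite (eq_bigr (fun x => l i x * (u' x)%:Z)); last by move=> y yj; rewrite h.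
  by move=> /addIr /(mulfI lj) [] /val_inj.
pose bad n : {set {ffun J -> 'I_n}} := (\bigcup_(p : I * 'I_(2 * B).+1) A n p.1 p.2)%SET.
pose N0 := #|{: I * 'I_(2 * B).+1}|.
have cardbad n : (#|bad n| * n <= N0 * n ^ #|J|)%N.
  apply: (@leq_trans ((\sum_(p : I * 'I_(2 * B).+1) #|A n p.1 p.2|) * n)%N).
    by rewrite leq_mul2r card_bigcup_le orbT.
  rewrite big_distrl /= -sum_nat_const; apply: leq_sum => p _; exact: cardA.
pose F n (u : {ffun J -> 'I_n}) : R[i] :=
  (g [ffun i => 0 <= L i n (fun j => u j : nat)])%:R.
have agree n m (u : {ffun J -> 'I_n}) (r : {ffun J -> 'I_m}) : (B < n)%N ->
    (0 < m)%N -> u \notin bad n -> F _ (digits (u, r)) = F _ u.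
  move=> Bn m0 ub; rewrite /F; congr ((nat_of_bool (g _))%:R); apply/ffunP => i.
  rewrite !ffunE !hL -/(l i) -/(c i) -/(e i).
  have -> : \sum_j l i j * (digits (u, r) j)%:Z =
      m%:Z * (\sum_j l i j * (u j)%:Z) + \sum_j l i j * (r j)%:Z.
    rewrite mulr_sumr -big_split; apply: eq_bigr => j _ /=.
    by rewrite ffunE /= PoszD PoszM; ring.
  have -> : m%:Z * (\sum_j l i j * (u j)%:Z) + \sum_j l i j * (r j)%:Z
      + c i + e i * (n * m)%:Z = m%:Z * q i n u + \sum_j l i j * (r j)%:Z + c i.
    by rewrite /q PoszM; ring.
  have -> : \sum_j l i j * (u j)%:Z + c i + e i * n%:Z = q i n u + c i.
    by rewrite /q; ring.
  have lr : `|\sum_j l i j * (r j)%:Z| <= (m%:Z - 1) * (\sum_j `|l i j|%N)%:Z.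
    apply: le_trans (ler_norm_sum _ _ _) _.
    rewrite (big_morph Posz PoszD (erefl 0%:Z)) mulr_sumr; apply: ler_sum => j _.
    rewrite normrM mulrC abszE; apply: ler_wpM2r => //.
    by have := ltn_ord (r j); lia.
  have lr2 : `|\sum_j l i j * (r j)%:Z + c i| <= m%:Z * (Bi i)%:Z.
    by move: lr; rewrite /Bi; move: (\sum_j _ * _) (\sum_j _)%N => X Y; nia.
  have m0' : 0 < m%:Z by lia.
  have [/existsP hl|] := boolP [exists j, l i j != 0]; last first.
    rewrite negb_exists => /forallP hl0.
    have h0 j : l i j = 0 by apply/eqP; have := hl0 j; rewrite negbK.
    have z1 : \sum_j l i j * (r j)%:Z = 0 by rewrite big1// => j _; rewrite h0 mul0r.
    have qe : q i n u = e i * n%:Z.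
      by rewrite /q big1 ?add0r// => j _; rewrite h0 mul0r.
    have [e0|e0] := eqVneq (e i) 0.
      by rewrite qe z1 e0 mul0r mulr0 !add0r.
    apply: (same_sign m0' (cB i) lr2).
    rewrite qe normrM; have := BiB i; move: (Bi i) => Y; nia.
  apply: (same_sign m0' (cB i) lr2).
  rewrite ltNge; apply: contra ub => hq.
  have qB : `|q i n u| <= B%:Z by have := BiB i; lia.
  have hb : (`|(q i n u + B%:Z)%R| < (2 * B).+1)%N by lia.
  apply/bigcupP; exists (i, Ordinal hb) => //=; rewrite inE; apply/andP; split.
    exact/existsP.
  by apply/eqP => /=; lia.
apply: (@cauchy_of_multiples _ _ N0%:R B.+1) => n m Bn n0 m0.
rewrite -/(F n) -/(F (n * m)%N).
have [f' fK f'K] := @digits_bij J n m.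
rewrite (reindex (@digits J n m))/=; last by exists f' => ? _; [exact: fK|exact: f'K].
rewrite -(pair_bigA _ (fun u r => F _ (digits (u, r)))) /=.
have nn0 : (n%:R : R) != 0 by rewrite pnatr_eq0 -lt0n.
have mm0 : (m%:R : R) != 0 by rewrite pnatr_eq0 -lt0n.
have mC0 : (m%:R : R[i]) != 0 by rewrite pnatr_eq0 -lt0n.
have -> : (n%:R^-1) ^+ #|J| * (\sum_u F n u) = ((n * m)%:R^-1) ^+ #|J| *
    (\sum_(u : {ffun J -> 'I_n}) \sum_(r : {ffun J -> 'I_m}) F n u).
  under [in RHS]eq_bigr do rewrite sumr_const card_ffun card_ord -mulr_natl.
  rewrite -mulr_sumr natrM invfM exprMn natrX -[in RHS]mulrA; congr (_ * _).
  by rewrite mulrA -exprMn mulVf// expr1n mul1r.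
rewrite -mulrBr cabsM cabsX cabsV cabs_nat.
have -> : (\sum_(u : {ffun J -> 'I_n}) \sum_(r : {ffun J -> 'I_m}) F _ (digits (u, r)) -
    \sum_(u : {ffun J -> 'I_n}) \sum_(r : {ffun J -> 'I_m}) F n u) =
  \sum_(u : {ffun J -> 'I_n} | u \in bad n) \sum_(r : {ffun J -> 'I_m})
    (F _ (digits (u, r)) - F n u).
  rewrite -sumrB [RHS]big_mkcond; apply: eq_bigr => u _. rewrite -sumrB.
  by case: ifPn => // ub; rewrite big1// => r _; rewrite agree ?subrr.
have hb : cabs (\sum_(u : {ffun J -> 'I_n} | u \in bad n)
    \sum_(r : {ffun J -> 'I_m}) (F _ (digits (u, r)) - F n u)) <=
    (#|bad n| * m ^ #|J|)%:R.
  apply: le_trans (cabs_sum _ _ _) _.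
  rewrite natrM mulr_natl -sumr_const; apply: ler_sum => u _.
  apply: le_trans (cabs_sum _ _ _) _.
  have -> : (m ^ #|J|)%:R = \sum_(r : {ffun J -> 'I_m}) 1 :> R.
    by rewrite sumr_const card_ffun card_ord.
  apply: ler_sum => r _; rewrite /F.
  by case: (g _); case: (g _); rewrite ?subrr ?subr0 ?sub0r ?cabsN ?cabs0 ?cabs1.
apply: le_trans (ler_wpM2l _ hb) _.
  by rewrite exprn_ge0// invr_ge0.
rewrite natrM invfM exprMn natrM natrX mulrACA -exprMn mulVf// expr1n mulr1.
rewrite ler_pdivlMr ?ltr0n// exprVn -mulrA mulrC ler_pdivrMr ?exprn_gt0 ?ltr0n//.
by rewrite -natrX -!natrM ler_nat.
Qed.
End lattice_density.

(** * Labellings and their partitions *)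

Section class_rep.
Variables (S : finType) (T : eqType).
Implicit Type f : S -> T.

(** The partition of [S] into the fibers of [f], encoded by a canonical element
    of each class, so that sums can be split over a finite set of partitions. *)
Definition class_rep f : {ffun S -> S} := [ffun s => odflt s [pick t | f t == f s]].

Lemma class_repP f s : f (class_rep f s) = f s.
Proof. by rewrite ffunE; case: pickP => [t /eqP|]. Qed.

Lemma class_rep_eq f s t : (class_rep f s == class_rep f t) = (f s == f t).
Proof.
apply/eqP/eqP => [h|h]; first by rewrite -class_repP h class_repP.
rewrite !ffunE h; case: pickP => // /(_ t).
by rewrite eqxx.
Qed.
End class_rep.

(** Canonicity: the representatives depend on the partition only. *)
Lemma class_rep_ext (S : finType) (T T' : eqType) (f : S -> T) (f' : S -> T') :
  (forall s t, (f s == f t) = (f' s == f' t)) -> class_rep f = class_rep f'.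
Proof.
move=> h; apply/ffunP => s; rewrite !ffunE.
by congr odflt; apply: eq_pick => t /=.
Qed.

Lemma class_repK (S : finType) (T : eqType) (f : S -> T) :
  class_rep (class_rep f) = class_rep f.
Proof. by apply: class_rep_ext => s t; rewrite class_rep_eq. Qed.

Lemma class_rep_idem (S : finType) (c : {ffun S -> S}) : class_rep c = c ->
  forall s, c (c s) = c s.
Proof. by move=> h s; rewrite -{2}h class_repP. Qed.

Section fibers.
Variables (S : finType) (c : {ffun S -> S}).
Hypothesis idem : forall s, c (c s) = c s.
Let r := #|[pred s | c s == s]|.

Let card_fibers : #|S| = (\sum_(x | c x == x) #|[pred t | c t == x]|)%N.
Proof.
rewrite -sum1_card (partition_big c (fun x => c x == x)) /=; last first.
  by move=> s _; rewrite idem.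
by apply: eq_bigr => x _; rewrite sum1_card.
Qed.

Lemma fixpoints_pairs :
  (forall s, #|[pred t | c t == c s]| = 2) -> (2 * r)%N = #|S|.
Proof.
move=> f2; rewrite card_fibers mulnC -sum_nat_const; apply: eq_bigr => x /eqP xx.
by have := f2 x; rewrite xx => ->.
Qed.

Hypothesis fiber2 : forall s, (1 < #|[pred t | c t == c s]|)%N.

Lemma fixpoints_le : (2 * r <= #|S|)%N.
Proof.
rewrite card_fibers mulnC -sum_nat_const; apply: leq_sum => x /eqP xx.
by have := fiber2 x; rewrite xx.
Qed.

Lemma fibers_pairs : #|S| = (2 * r)%N -> forall s, #|[pred t | c t == c s]| = 2.
Proof.
move=> h s; apply/eqP; rewrite eqn_leq fiber2 andbT leqNgt; apply/negP => h3.
suff : (2 * r < #|S|)%N by rewrite h ltnn.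
rewrite card_fibers /r -sum1_card big_distrr /=.
rewrite (bigD1 (c s)) ?inE ?idem//= [ltnRHS](bigD1 (c s)) ?idem//=.
rewrite muln1 -addSn leq_add//; apply: leq_sum => x /andP[/eqP xx _].
by have := fiber2 x; rewrite xx.
Qed.
End fibers.

Section labelling_sum.
Variables (R : realType) (S : finType) (I : eqType) (col : S -> I).

Definition cls n (m : {ffun S -> 'I_n}) (s : S) : I * nat := (col s, m s : nat).

Definition has_singleton n (m : {ffun S -> 'I_n}) : Prop :=
  exists s, forall t, cls m t = cls m s -> t = s.

(** The factor [1/n] of the normalised trace times one factor [1/sqrt n] for each
    random letter, the random letters being indexed by [S]. *)
Definition scaling n : R[i] := n%:R^-1 * (Num.sqrt n%:R)^-1%:C ^+ #|S|.

Lemma cabs_scaling n : (0 < n)%N ->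
  cabs (scaling n) = n%:R^-1 * (Num.sqrt n%:R)^-1 ^+ #|S|.
Proof.
move=> n0; rewrite /scaling cabsM cabsX cabsV cabs_nat cabs_real.
by rewrite ger0_norm// invr_ge0 sqrtr_ge0.
Qed.

Lemma sqrt_nat_ge1 n : (0 < n)%N -> 1 <= Num.sqrt (n%:R : R).
Proof. by move=> n0; rewrite -[leLHS]sqrtr1 ler_wsqrtr// ler1n. Qed.

(** A labelling [m] with partition [c] is determined by its values on the [r]
    fixed points of [c], so there are at most [n ^ r] of them. This is
    compensated by the scaling exactly when [2 * r <= #|S|]. *)
Lemma class_sum_bound n (c : {ffun S -> S}) (F : {ffun S -> 'I_n} -> R[i])
    (C : R) : (0 < n)%N -> 0 <= C ->
  (forall m, cabs (F m) <= C * n%:R) ->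
  cabs (scaling n * \sum_(m | class_rep (cls m) == c) F m) <=
    C * ((Num.sqrt n%:R)^-1 ^+ #|S| *
         Num.sqrt n%:R ^+ (2 * #|[pred s | c s == s]|)%N).
Proof.
move=> n0 C0 hF.
have nn0 : (n%:R : R) != 0 by rewrite pnatr_eq0 -lt0n.
rewrite cabsM cabs_scaling//.
have hcard : (#|[pred m : {ffun S -> 'I_n} | class_rep (cls m) == c]| <=
    n ^ #|[pred s | c s == s]|)%N.
  pose res (m : {ffun S -> 'I_n}) : {ffun {s | c s == s} -> 'I_n} :=
    [ffun x => m (val x)].
  have <- : #|{ffun {s | c s == s} -> 'I_n}| = (n ^ #|[pred s | c s == s]|)%N.
    by rewrite card_ffun card_ord card_sig.
  apply: (@leq_card_in _ _ res).
  move=> m m' /eqP hm /eqP hm' /ffunP e; apply/ffunP => s; apply: val_inj.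
  have h1 : (m (c s) : nat) = m s by have := class_repP (cls m) s; rewrite hm => -[].
  have h2 : (m' (c s) : nat) = m' s by have := class_repP (cls m') s; rewrite hm' => -[].
  have cc : c (c s) == c s by rewrite class_rep_idem// -hm class_repK.
  by have := e (exist _ (c s) cc); rewrite !ffunE /= -h1 -h2 => ->.
have hs : cabs (\sum_(m | class_rep (cls m) == c) F m) <=
    C * n%:R * n%:R ^+ #|[pred s | c s == s]|.
  apply: le_trans (cabs_sum _ _ _) _.
  apply: (@le_trans _ _ (\sum_(m : {ffun S -> 'I_n} | class_rep (cls m) == c) (C * n%:R))).
    by apply: ler_sum => m _; exact: hF.
  rewrite sumr_const.
  by rewrite -(mulr_natr (C * n%:R)) -natrX ler_wpM2l ?mulr_ge0// ler_nat.
apply: le_trans (ler_wpM2l _ hs) _.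
  by rewrite mulr_ge0// ?exprn_ge0 ?invr_ge0 ?sqrtr_ge0.
rewrite exprM sqr_sqrtr//; set X := _ ^+ #|S|; set Y := _ ^+ _.
by rewrite le_eqVlt; apply/orP; left; apply/eqP; field.
Qed.

(** If no class is a singleton there are at most [#|S| / 2] classes, with
    equality only for pairings. *)
Lemma class_sum_trichotomy n (c : {ffun S -> S}) (F : {ffun S -> 'I_n} -> R[i]) :
  (forall m, has_singleton m -> F m = 0) ->
  [\/ \sum_(m | class_rep (cls m) == c) F m = 0,
      (2 * #|[pred s | c s == s]| < #|S|)%N |
      [/\ class_rep c = c, (forall s, col (c s) = col s),
          (2 * #|[pred s | c s == s]| = #|S|)%N &
          forall s, #|[pred t | c t == c s]| = 2] ].
Proof.
move=> h0.
have [/eqP kc|kc] := boolP (class_rep c == c); last first.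
  constructor 1; rewrite big_pred0// => m; apply: contraNF kc => /eqP <-.
  by rewrite class_repK.
have [/forallP cc|/forallPn[s cc]] := boolP [forall s, col (c s) == col s]; last first.
  constructor 1; rewrite big_pred0// => m; apply: contraNF cc => /eqP <-.
  by have := class_repP (cls m) s => -[-> _].
have [/forallP f2|] := boolP [forall s, 1 < #|[pred t | c t == c s]|]%N; last first.
  move=> /forallPn[s hs]; constructor 1; apply: big1 => m /eqP hm; apply: h0.
  exists s => t e.
  have ts : c t == c s by rewrite -hm class_rep_eq e.
  apply: contraNeq hs => nts; apply/card_gt1P; exists t, s.
  by rewrite !inE eqxx ts.
have idem := class_rep_idem kc.
have := fixpoints_le idem f2; rewrite leq_eqVlt => /orP[/eqP h|h]; last by constructor 2.
constructor 3; split=> //; first by move=> s; apply/eqP.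
exact: fibers_pairs.
Qed.

Lemma sqrt_powers_le (n a b : nat) : (0 < n)%N -> (a <= b)%N ->
  (Num.sqrt n%:R)^-1 ^+ b * Num.sqrt n%:R ^+ a <= 1 :> R.
Proof.
move=> n0 ab; have q1 := sqrt_nat_ge1 n0.
have q0 : 0 < Num.sqrt (n%:R : R) by apply: lt_le_trans q1.
rewrite exprVn mulrC ler_pdivrMr ?exprn_gt0// mul1r.
exact: ler_weXn2l.
Qed.

Lemma labelling_sum_bound n (F : {ffun S -> 'I_n} -> R[i]) (C : R) :
  (0 < n)%N -> 0 <= C -> (forall m, cabs (F m) <= C * n%:R) ->
  (forall m, has_singleton m -> F m = 0) ->
  cabs (scaling n * \sum_m F m) <= C * #|{ffun S -> S}|%:R.
Proof.
move=> n0 C0 hF h0.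
rewrite (partition_big (fun m => class_rep (cls m)) predT)//= mulr_sumr.
apply: le_trans (cabs_sum _ _ _) _.
rewrite mulr_natr -sumr_const; apply: ler_sum => c _.
have [->|h|[_ _ h _]] := class_sum_trichotomy c h0.
- by rewrite mulr0 cabs0.
- apply: le_trans (class_sum_bound c n0 C0 hF) _.
  by rewrite ler_piMr// sqrt_powers_le// ltnW.
- apply: le_trans (class_sum_bound c n0 C0 hF) _.
  by rewrite ler_piMr// sqrt_powers_le// h.
Qed.
End labelling_sum.

(** * Asymptotics of sums over labellings *)

Lemma affine_subst (J J' : Type) (f : J -> J') (L : nat -> (J -> nat) -> int) :
  affine_form L -> affine_form (fun n (u : J' -> nat) => L n (fun j => u (f j))).
Proof.
move=> [s [c [e h]]]; exists [seq (t.1, f t.2) | t <- s], c, e => n u.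
by rewrite h big_map.
Qed.

Section labelling_sum_cauchy.
Variables (R : realType) (S : finType) (I : eqType) (col : S -> I).

Definition with_base n (k : nat) (m : {ffun S -> 'I_n}) (o : option S) : nat :=
  if o is Some s then m s else k.

Section pairing.
Variable c : {ffun S -> S}.
Hypothesis kc : class_rep c = c.
Hypothesis colc : forall s, col (c s) = col s.

Notation J := {s : S | c s == s}.

Lemma rep_subproof s : c (c s) == c s.
Proof. by rewrite class_rep_idem. Qed.

Definition rep (s : S) : J := exist _ (c s) (rep_subproof s).

Lemma rep_val (j : J) : rep (val j) = j.
Proof. by apply: val_inj => /=; exact/eqP/(valP j). Qed.

Lemma rep_eq s t : (rep s == rep t) = (c s == c t).
Proof. by []. Qed.

(** Labellings with partition [c] seen as functions on the set of classes. *)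
Definition spread n (v : {ffun J -> 'I_n}) : {ffun S -> 'I_n} :=
  [ffun s => v (rep s)].

(** For such labellings, the partition is exactly [c] and all labels are
    positive; the labels are absolute values of diagonals, and the main diagonal
    is not covered by the covariance assumptions. *)
Definition generic n (v : {ffun J -> 'I_n}) : bool :=
  injectiveb v && [forall j, 0 < v j]%N.

Lemma class_rep_spread n (v : {ffun J -> 'I_n}) :
  generic v -> class_rep (cls col (spread v)) = c.
Proof.
move=> /andP[/injectiveP inj _]; rewrite -[RHS]kc.
apply: class_rep_ext => s t; rewrite /cls !ffunE xpair_eqE val_eqE (inj_eq inj) rep_eq.
have [h|_] := eqVneq (c s) (c t); last by rewrite andbF.
by rewrite -(colc s) -(colc t) h eqxx.
Qed.

Lemma sum_spread n (F : {ffun S -> 'I_n} -> R[i]) :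
  \sum_(m | class_rep (cls col m) == c) F m =
  \sum_(v | class_rep (cls col (spread v)) == c) F (spread v).
Proof.
pose res (m : {ffun S -> 'I_n}) : {ffun J -> 'I_n} := [ffun j => m (val j)].
rewrite (reindex_onto (@spread n) res); last first.
  move=> m /eqP hm; apply/ffunP => s; rewrite !ffunE /=; apply: val_inj.
  by have := class_repP (cls col m) s; rewrite hm => -[].
apply: eq_bigl => v; rewrite (_ : res _ = v) ?eqxx ?andbT//.
by apply/ffunP => j; rewrite !ffunE rep_val.
Qed.

Lemma card_not_generic n :
  (#|[pred v : {ffun J -> 'I_n} | ~~ generic v]| * n <=
     (#|{: J}| + #|{: J * J}|) * n ^ #|{: J}|)%N.
Proof.
pose Z (j : J) : {set {ffun J -> 'I_n}} := [set v : {ffun J -> 'I_n} | v j == 0 :> nat]%SET.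
pose D (p : J * J) : {set {ffun J -> 'I_n}} :=
  [set v : {ffun J -> 'I_n} | (p.1 != p.2) && (v p.1 == v p.2)]%SET.
have hZ j : (#|Z j| * n <= n ^ #|{: J}|)%N.
  apply: (@card_determined _ j) => u u'; rewrite !inE => /eqP h /eqP h' e.
  apply/ffunP => x; have [->|] := eqVneq x j; last exact: e.
  by apply: val_inj => /=; rewrite h h'.
have hD p : (#|D p| * n <= n ^ #|{: J}|)%N.
  have [e|ne] := eqVneq p.1 p.2.
    rewrite (_ : D p = finset.set0) ?cards0// .
    by apply/setP => v; rewrite !inE e eqxx.
  apply: (@card_determined _ p.1) => u u'; rewrite !inE ne /= => /eqP h /eqP h' e.
  apply/ffunP => x; have [->|] := eqVneq x p.1; last exact: e.
  by rewrite h h' e // eq_sym.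
apply: (@leq_trans ((\sum_j #|Z j| + \sum_p #|D p|) * n)%N).
  rewrite leq_mul2r; apply/orP; right.
  pose U := ((\bigcup_j Z j) :|: (\bigcup_p D p))%SET.
  apply: (@leq_trans #|U|).
    apply/subset_leq_card/fintype.subsetP => v; rewrite inE /generic negb_and.
    move=> /orP[/injectivePn[j [j' jj' e]]|/forallPn[j hj]]; rewrite finset.in_setU; apply/orP.
      by right; apply/bigcupP; exists (j, j') => //; rewrite inE /= jj' e eqxx.
    by left; apply/bigcupP; exists j => //; rewrite inE eqn0Ngt.
  by apply: leq_trans (leq_card_setU _ _) _; rewrite leq_add ?card_bigcup_le.
rewrite !mulnDl !big_distrl /= -!sum_nat_const.
by apply: leq_add; apply: leq_sum => ? _; [exact: hZ|exact: hD].
Qed.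

(** Away from the labellings that are not generic, the summand is a constant
    times the indicator of a system of affine inequalities, so that
    [lattice_density] applies in [#|S| / 2 + 1] variables: one for each pair and
    one for the starting point [b] of the walk. *)
Lemma pairing_sum_cauchy (K : finType) (L : K -> nat -> (option S -> nat) -> int)
    (g : {ffun K -> bool} -> bool) (E : forall n, {ffun S -> 'I_n} -> R[i])
    (C : R) (kappa : R[i]) :
  (2 * #|[pred s | c s == s]| = #|S|)%N ->
  (forall k, affine_form (L k)) -> 0 <= C ->
  (forall n (m : {ffun S -> 'I_n}), (0 < n)%N -> cabs (E n m) <= C) ->
  (forall n (m : {ffun S -> 'I_n}), (0 < n)%N -> (forall s, 0 < m s)%N ->
     class_rep (cls col m) = c -> E n m = kappa) ->
  cauchy_sequence (fun n => scaling R S n * \sum_(m | class_rep (cls col m) == c)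
    E n m * \sum_(b < n) (g [ffun k => 0 <= L k n (with_base b m)])%:R).
Proof.
move=> cardS hL C0 hE hk.
pose t n m : R[i] := \sum_(b < n) (g [ffun k => 0 <= L k n (@with_base n b m)])%:R.
have ht n m : cabs (@t n m) <= n%:R by exact: cabs_sum_indicator.
pose r := #|{: J}|.
have cardJ : #|[pred s | c s == s]| = r by rewrite /r card_sig.
have scalingE n : (0 < n)%N -> scaling R S n = n%:R^-1 ^+ r.+1.
  move=> n0; rewrite /scaling -cardS cardJ exprM [RHS]exprS; congr (_ * _ ^+ _).
  rewrite -[LHS](rmorphXn (real_complex R)) exprVn sqr_sqrtr ?ler0n//.
  by rewrite (fmorphV (real_complex R)) (rmorph_nat (real_complex R)).
pose v n := kappa * (n%:R^-1 ^+ r.+1 * \sum_(v : {ffun J -> 'I_n}) t n (spread v)).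
have cv : cauchy_sequence v.
  apply: cauchyZ.
  pose ren (o : option S) : option J := omap rep o.
  pose L' k n (u : option J -> nat) := L k n (fun o => u (ren o)).
  have := @lattice_density R _ _ L' g (fun k => affine_subst ren (hL k)).
  rewrite card_option; apply: eq_cauchy => n n0; congr (_ * _).
  pose mk (p : {ffun J -> 'I_n} * 'I_n) : {ffun option J -> 'I_n} :=
    [ffun o => if o is Some j then p.1 j else p.2].
  pose mk' (u : {ffun option J -> 'I_n}) : {ffun J -> 'I_n} * 'I_n :=
    ([ffun j => u (Some j)], u None).
  rewrite (reindex mk); last first.
    exists mk' => [[w b] _|u _]; last by apply/ffunP => -[j|]; rewrite !ffunE.
    by rewrite /mk' !ffunE; congr (_, _); apply/ffunP => j; rewrite !ffunE.
  rewrite /t pair_bigA /=; apply: eq_bigr => -[w b] _.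
  congr ((nat_of_bool (g _))%:R); apply/ffunP => k; rewrite !ffunE /L'.
  by congr (0 <= L k n _); apply/funext => -[s|] /=; rewrite !ffunE.
pose N0 := (#|{: J}| + #|{: J * J}|)%N.
apply: (cauchy_eventually_close (C := N0%:R * (C + cabs kappa)) cv) => n n0.
rewrite scalingE// /v mulrCA -mulrBr sum_spread mulr_sumr big_mkcond -sumrB /=.
rewrite cabsM cabsX cabsV cabs_nat.
have kap0 := cabs_ge0 kappa.
have nn0 : (n%:R : R) != 0 by rewrite pnatr_eq0 -lt0n.
set X := \sum_i _.
have hX : cabs X <= #|[pred v : {ffun J -> 'I_n} | ~~ generic v]|%:R *
    ((C + cabs kappa) * n%:R).
  apply: le_trans (cabs_sum _ _ _) _.
  rewrite mulr_natl -sumr_const [leRHS]big_mkcond; apply: ler_sum => w _ /=.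
  rewrite inE; have [gw|gw] := boolP (generic w).
    rewrite class_rep_spread// eqxx (hk n (spread w))//.
    - by rewrite subrr cabs0.
    - by move=> s; rewrite ffunE; case/andP: gw => _ /forallP.
    - exact: class_rep_spread.
  rewrite mulrDl (le_trans (cabsB _ _))// lerD//; last first.
    by rewrite cabsM; apply: ler_wpM2l => //; exact: ht.
  case: ifP => _; last by rewrite cabs0 mulr_ge0.
  by rewrite cabsM; apply: ler_pM; rewrite ?cabs_ge0 ?hE//; exact: ht.
apply: le_trans (ler_wpM2l _ hX) _; first by rewrite exprn_ge0// invr_ge0.
apply: (@le_trans _ _ (N0%:R * (C + cabs kappa) / n%:R)); last first.
  rewrite ler_wpM2l ?mulr_ge0 ?addr_ge0//.
  have q1 := sqrt_nat_ge1 R n0.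
  have q0 : 0 < Num.sqrt (n%:R : R) by apply: lt_le_trans q1.
  rewrite lef_pV2 ?posrE ?ltr0n// -[leRHS]sqr_sqrtr ?ler0n//.
  by rewrite expr2 ler_peMr// ltW.
rewrite ler_pdivlMr ?ltr0n// exprVn -mulrA mulrC ler_pdivrMr ?exprn_gt0 ?ltr0n//.
have -> : #|[pred v : {ffun J -> 'I_n} | ~~ generic v]|%:R *
    ((C + cabs kappa) * n%:R) * n%:R = (C + cabs kappa) * n%:R *
   (#|[pred v : {ffun J -> 'I_n} | ~~ generic v]| * n)%:R.
  by rewrite natrM; ring.
have -> : N0%:R * (C + cabs kappa) * n%:R ^+ r.+1 =
  (C + cabs kappa) * n%:R * (N0 * n ^ r)%:R.
  by rewrite natrM natrX exprS; ring.
by rewrite ler_wpM2l ?mulr_ge0 ?addr_ge0// ler_nat card_not_generic.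
Qed.
End pairing.

(** Only pairings contribute to the limit: a labelling with a singleton class
    contributes nothing, and one with no singleton that is not a pairing has
    fewer than [#|S| / 2] classes, hence is negligible. *)
Lemma labelling_sum_cauchy (K : finType) (L : K -> nat -> (option S -> nat) -> int)
    (g : {ffun K -> bool} -> bool) (E : forall n, {ffun S -> 'I_n} -> R[i])
    (C : R) (kappa : {ffun S -> S} -> R[i]) :
  (forall k, affine_form (L k)) -> 0 <= C ->
  (forall n (m : {ffun S -> 'I_n}), (0 < n)%N -> cabs (E n m) <= C) ->
  (forall n (m : {ffun S -> 'I_n}), has_singleton col m -> E n m = 0) ->
  (forall n (m : {ffun S -> 'I_n}), (0 < n)%N -> (forall s, 0 < m s)%N ->
     (forall s, #|[pred t | class_rep (cls col m) t == class_rep (cls col m) s]| = 2) ->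
     E n m = kappa (class_rep (cls col m))) ->
  cauchy_sequence (fun n => scaling R S n * \sum_(m : {ffun S -> 'I_n})
    E n m * \sum_(b < n) (g [ffun k => 0 <= L k n (with_base b m)])%:R).
Proof.
move=> hL C0 hE h0 h2.
pose F n (m : {ffun S -> 'I_n}) : R[i] :=
  E n m * \sum_(b < n) (g [ffun k => 0 <= L k n (with_base b m)])%:R.
have hF n m : (0 < n)%N -> cabs (F n m) <= C * n%:R.
  move=> n0; rewrite cabsM ler_pM ?cabs_ge0 ?hE//.
  exact: cabs_sum_indicator.
have hF0 n (m : {ffun S -> 'I_n}) : has_singleton col m -> F n m = 0.
  by move=> hm; rewrite /F h0// mul0r.
have split n : \sum_(c : {ffun S -> S}) scaling R S n *
    (\sum_(m | class_rep (cls col m) == c) F n m) = scaling R S n * \sum_m F n m.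
  by rewrite (partition_big (fun m => class_rep (cls col m)) predT)//= mulr_sumr.
apply: eq_cauchy (fun n _ => split n) _; apply: cauchy_sum => c.
have [kc|nkc] := eqVneq (class_rep c) c; last first.
  apply: eq_cauchy (cauchy_cst 0) => n n0; rewrite big_pred0 ?mulr0// => m.
  by apply: contraNF nkc => /eqP <-; rewrite class_repK.
have [/forallP colc|/forallPn[s cc]] := boolP [forall s, col (c s) == col s]; last first.
  apply: eq_cauchy (cauchy_cst 0) => n n0; rewrite big_pred0 ?mulr0// => m.
  by apply: contraNF cc => /eqP <-; have := class_repP (cls col m) s => -[-> _].
have [f2|f2] := boolP [forall s, #|[pred t | c t == c s]| == 2].
  have f2' s : #|[pred t | c t == c s]| = 2 by apply/eqP/(forallP f2).
  have h := fixpoints_pairs (class_rep_idem kc) f2'.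
  apply: (pairing_sum_cauchy kc (fun s => eqP (colc s)) _ h hL C0 hE
           (kappa := kappa c)) => n m n0 m0 km.
  by rewrite h2 ?km// => s; rewrite ?km f2'.
apply: (cauchy_eventually_close (C := C) (cauchy_cst 0)) => n n0; rewrite subr0.
have q1 := sqrt_nat_ge1 R n0.
have q0 : 0 < Num.sqrt (n%:R : R) by apply: lt_le_trans q1.
have [->|h|[_ _ _ h]] := class_sum_trichotomy c (hF0 n).
- by rewrite mulr0 cabs0 divr_ge0// ltW.
- have hb := class_sum_bound col c n0 C0 (fun m => hF n m n0).
  apply: le_trans hb _.
  rewrite ler_wpM2l// -(ler_pM2r q0) mulVf ?gt_eqF// -mulrA -exprSr.
  exact: sqrt_powers_le.
- by case/negP: f2; apply/forallP => s; rewrite h.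
Qed.
End labelling_sum_cauchy.

(** * Dominated convergence and closed walks *)

Section tannery.
Variable R : realType.

Lemma bounded_partial_sums_tail (a : nat -> R) (D : R) :
  (forall i, 0 <= a i) -> (forall N, \sum_(i < N) a i <= D) ->
  forall e, 0 < e -> exists N, forall n, (N <= n)%N ->
    \sum_(N <= i < n) a i <= e.
Proof.
move=> a0 hD e e0.
pose A : set R := [set y | exists N, y = \sum_(i < N) a i].
have hA : has_sup A.
  split; first by exists (\sum_(i < 0) a i), 0.
  by exists D => y [N ->].
have [y [N ->] hN] := sup_adherent e0 hA.
exists N => n Nn.
have : \sum_(i < n) a i <= sup A by apply: sup_upper_bound => //; exists n.
move: hN; rewrite -!(big_mkord xpredT a) (big_cat_nat (leq0n N) Nn)/=; lra.
Qed.

(** Dominated convergence for series with a moving truncation. *)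
Lemma tannery (f : nat -> R[i]) (c : nat -> nat -> R[i]) (C D : R) :
  0 <= C -> (forall N, \sum_(i < N) cabs (f i) <= D) ->
  (forall i, cauchy_sequence (c ^~ i)) ->
  (forall n i, (0 < n)%N -> cabs (c n i) <= C) ->
  cauchy_sequence (fun n => \sum_(i < n) f i * c n i).
Proof.
move=> C0 hD hc hC; apply: cauchy_approx => e e0.
have e1 : 0 < e / (C + 1) by rewrite divr_gt0// ltr_wpDl.
have [N hN] := bounded_partial_sums_tail (fun i => cabs_ge0 (f i)) hD e1.
exists (fun n => \sum_(i < N) f i * c n i); split.
  by apply: cauchy_sum => i; apply: cauchyZ.
exists N.+1 => n Nn.
have n0 : (0 < n)%N by exact: leq_trans Nn.
rewrite -!(big_mkord xpredT (fun i => f i * c n i)).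
rewrite (big_cat_nat (leq0n N) (ltnW Nn))/= addrAC subrr add0r.
apply: le_trans (cabs_sum _ _ _) _.
apply: (@le_trans _ _ (C * \sum_(N <= i < n) cabs (f i))).
  rewrite mulr_sumr; apply: ler_sum => i _; rewrite cabsM mulrC.
  by rewrite ler_wpM2r ?cabs_ge0 ?hC.
apply: le_trans (ler_wpM2l C0 (hN _ (ltnW Nn))) _.
by rewrite mulrCA ler_piMr ?(ltW e0)// ler_pdivrMr ?mul1r ?lerDl// ltr_wpDl.
Qed.
End tannery.

Definition signed (neg : bool) (m : nat) : int := if neg then - m%:Z else m%:Z.

Section paths.
Variables (K : nat) (flip : nat -> bool).

(** The quantity that is fixed when one factor of the product is a
    point mass: the diagonal [k - l] for a Toeplitz matrix, and the
    anti-diagonal [n - 1 - k - l] for the backward identity. *)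
Definition offset n (k : {ffun 'I_K.+1 -> 'I_n}) (j : nat) : int :=
  if flip j then n%:Z - 1 - (k (inord j))%:Z - (k (inord j.+1))%:Z
  else (k (inord j))%:Z - (k (inord j.+1))%:Z.

Lemma offset_lt n (k : {ffun 'I_K.+1 -> 'I_n}) j : (`|offset k j| < n)%N.
Proof.
rewrite /offset; have := ltn_ord (k (inord j)); have := ltn_ord (k (inord j.+1)).
by case: (flip j) => /=; lia.
Qed.

(** The index reached after [j] steps of the walk that starts at [b] and has
    offsets [H]. *)
Fixpoint position (n : int) (b : int) (H : nat -> int) (j : nat) : int :=
  if j is j'.+1 then
    (if flip j' then n - 1 - position n b H j' else position n b H j') - H j'
  else b.

Definition closed_walk n (k : {ffun 'I_K.+1 -> 'I_n}) (H : nat -> int) : bool :=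
  (k ord0 == k ord_max) && [forall j : 'I_K, offset k j == H j].

(** The walk stays in [[0, n)] and comes back to [b] when all these forms are
    non-negative; the two forms [inr] express the closing equation. *)
Definition walk_forms (H : nat -> int) (n : int) (b : int)
    (i : 'I_K.+1 * bool + bool) : int :=
  match i with
  | inl (j, false) => position n b H j
  | inl (j, true) => n - 1 - position n b H j
  | inr false => position n b H K - b
  | inr true => b - position n b H K
  end.

(** A walk with prescribed steps is determined by its starting point, and the
    constraints that it stays in the box and closes up are affine. *)
Lemma count_closed_walks n (H : nat -> int) :
  #|[pred k : {ffun 'I_K.+1 -> 'I_n} | closed_walk k H]| =
  #|[pred b : 'I_n | [forall i, 0 <= walk_forms H n%:Z b%:Z i]]|.
Proof.
have posE (k : {ffun 'I_K.+1 -> 'I_n}) : closed_walk k H ->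
    forall j, (j <= K)%N -> position n%:Z (k ord0)%:Z H j = (k (inord j))%:Z.
  move=> /andP[_ /forallP h]; elim=> [_|j IH jK] /=.
    by congr (nat_of_ord (k _))%:Z; apply: val_inj; rewrite /= inordK.
  rewrite IH ?(ltnW jK)//; have /eqP := h (Ordinal jK); rewrite /offset /=.
  by case: (flip j); lia.
have fe (k : {ffun 'I_K.+1 -> 'I_n}) : k ord_max = k (inord K).
  by congr (k _); apply: val_inj; rewrite /= inordK.
rewrite -[LHS](card_in_imset (f := fun k : {ffun 'I_K.+1 -> 'I_n} => k ord0)); last first.
  move=> k k' hk hk' e; apply/ffunP => j; apply: val_inj; apply/eqP.
  have jK : (j <= K)%N by rewrite -ltnS.
  have := posE k hk j jK; have := posE k' hk' j jK.
  by rewrite e inord_val => -> [h]; rewrite /= h.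
apply: eq_card => b; apply/imsetP/forallP => [[k hk ->] i|h].
  have hp := posE k hk.
  case: i => [[j []]|[]] /=.
  - have jK : (j <= K)%N by rewrite -ltnS.
    have lt0 (x y : nat) : (x < y)%N -> 0 <= y%:Z - 1 - x%:Z by lia.
    by rewrite (hp _ jK) lt0.
  - have jK : (j <= K)%N by rewrite -ltnS.
    by rewrite (hp _ jK).
  - by rewrite (hp _ (leqnn K)) -fe; case/andP: hk => /eqP -> _; rewrite subrr.
  - by rewrite (hp _ (leqnn K)) -fe; case/andP: hk => /eqP -> _; rewrite subrr.
have hpos j : (j <= K)%N -> 0 <= position n%:Z b%:Z H j /\
    position n%:Z b%:Z H j < n%:Z.
  move=> jK; have jK' : (j < K.+1)%N by [].
  have := h (inl (Ordinal jK', false)); have := h (inl (Ordinal jK', true)).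
  by rewrite /=; lia.
pose k : {ffun 'I_K.+1 -> 'I_n} :=
  [ffun j : 'I_K.+1 => insubd b `|position n%:Z b%:Z H j|%N].
have kE j : (j <= K)%N -> (k (inord j))%:Z = position n%:Z b%:Z H j.
  move=> jK; rewrite ffunE inordK// val_insubd.
  by have := hpos _ jK; case: ifP; lia.
have k0 : k ord0 = b.
  apply: val_inj; have := kE 0 isT => /=.
  by rewrite (_ : inord 0 = ord0) => [[]|]//; apply: val_inj; rewrite /= inordK.
exists k => //; rewrite inE /closed_walk k0 fe.
apply/andP; split.
  have := h (inr false); have := h (inr true); have := kE K (leqnn K) => /=.
  by move=> e h1 h2; apply/eqP; apply: val_inj => /=; lia.
apply/forallP => j; have := ltn_ord j => jK; rewrite /offset.
have := kE j (ltnW jK); have := kE j.+1 jK => /= -> ->.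
by apply/eqP; case: (flip j); lia.
Qed.

Lemma affine_walk_forms (J : Type) (H : nat -> (J -> nat) -> int) (o : J) i :
  (forall j, affine_form (fun _ u => H j u)) ->
  affine_form (fun n u => walk_forms (H ^~ u) n%:Z (u o)%:Z i).
Proof.
move=> hH.
have hp j : affine_form (fun n u => position n%:Z (u o)%:Z (H ^~ u) j).
  elim: j => [|j IH]/=; first exact: affine_var.
  case: (flip j); apply: affineD (affineN (hH j)) => //.
  apply: affineD (affineN IH); apply: affineD (affine_size J) _.
  exact: affine_cst.
case: i => [[j []]|[]] /=.
- apply: affineD (affineN (hp _)); apply: affineD (affine_size J) _.
  exact: affine_cst.
- exact: hp.
- by apply: affineD (affineN (hp _)); exact: affine_var.
- by apply: affineD (hp _) _; apply: affineN; exact: affine_var.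
Qed.
End paths.

(** * Weighted sums over closed walks *)

Section walk_sums.
Variables (R : realType) (K : nat) (flip rnd : nat -> bool).
Notation S := {s : 'I_K | rnd s}.
Variables (I : eqType) (col : S -> I) (En : nat -> (S -> int) -> R[i]) (C : R).

Hypothesis C_ge0 : 0 <= C.
Hypothesis En_bounded : forall n (h : S -> int), (0 < n)%N ->
  (forall s, (`|h s| < n)%N) -> cabs (En n h) <= C.
Hypothesis En_singleton : forall (neg : {ffun S -> bool}) n (m : {ffun S -> 'I_n}),
  has_singleton col m -> En n (fun s => signed (neg s) (m s)) = 0.
Hypothesis En_pairing : forall neg : {ffun S -> bool},
  exists kappa : {ffun S -> S} -> R[i],
  forall n (m : {ffun S -> 'I_n}), (0 < n)%N -> (forall s, 0 < m s)%N ->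
    (forall s, #|[pred t | class_rep (cls col m) t == class_rep (cls col m) s]| = 2) ->
    En n (fun s => signed (neg s) (m s)) = kappa (class_rep (cls col m)).

(** The normalised trace of a word, expanded over closed walks: [w] gives the
    entries of the deterministic letters as functions of the offset, and [En] the
    mixed moment of the random ones. *)
Definition walk_sum (w : nat -> int -> R[i]) n : R[i] :=
  scaling R S n * \sum_(k : {ffun 'I_K.+1 -> 'I_n} | k ord0 == k ord_max)
    (\prod_(j < K | ~~ rnd j) w j (offset flip k j)) *
    En n (fun s : S => offset flip k (val s)).

Definition point_mass (a : int) : int -> R[i] := fun b => (b == a)%:R.

Definition step_of (a : nat -> int) (neg : {ffun S -> bool}) (m : S -> nat)
    (j : nat) : int :=
  if [pick s : S | val (val s) == j] is Some s then signed (neg s) (m s) else a j.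

Lemma step_of_rnd a neg m (s : S) :
  step_of a neg m (val (val s)) = signed (neg s) (m s).
Proof.
rewrite /step_of; case: pickP => [t /eqP e|/(_ s)]; last by rewrite eqxx.
by have -> : t = s by apply: val_inj; apply: val_inj.
Qed.

Lemma step_of_det a neg m j : ~~ rnd j -> step_of a neg m j = a j.
Proof.
rewrite /step_of; case: pickP => // s /eqP <-.
by rewrite (valP s).
Qed.

(* Zero is represented with the sign [false] only. *)
Definition reduced n (neg : {ffun S -> bool}) (m : {ffun S -> 'I_n}) : bool :=
  [forall s, neg s ==> (0 < m s)%N].

Lemma sum_signed_offsets n (k : {ffun 'I_K.+1 -> 'I_n}) (F : (S -> int) -> R[i]) :
  F (fun s : S => offset flip k (val s)) =
  \sum_(neg : {ffun S -> bool}) \sum_(m : {ffun S -> 'I_n} |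
    reduced neg m && [forall s : S, offset flip k (val s) == signed (neg s) (m s)])
    F (fun s => signed (neg s) (m s)).
Proof.
pose neg0 : {ffun S -> bool} := [ffun s : S => offset flip k (val s) < 0].
pose m0 : {ffun S -> 'I_n} := [ffun s : S => Ordinal (offset_lt flip k (val s))].
have e0 s : signed (neg0 s) (m0 s) = offset flip k (val s).
  by rewrite /signed !ffunE /=; case: ltP; lia.
rewrite (bigD1 neg0)//= (bigD1 m0)/=; last first.
  apply/andP; split; apply/forallP => s; last by rewrite e0.
  by rewrite !ffunE /=; apply/implyP; lia.
rewrite !big1 ?addr0; first by congr F; apply/funext => s; rewrite e0.
- move=> neg nneg; rewrite big1// => m /andP[/forallP r /forallP h].
  case/eqP: nneg; apply/ffunP => s; have := h s; have := r s.
  have -> : neg0 s = (offset flip k (val s) < 0) by rewrite ffunE.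
  by rewrite /signed => /implyP + /eqP ->; case: (neg s) => [/(_ isT)|_]; lia.
- move=> m /andP[/andP[/forallP r /forallP h]] nm; case/eqP: nm.
  apply/ffunP => s; apply: val_inj; have := h s.
  have -> : val (m0 s) = `|offset flip k (val s)|%N by rewrite ffunE.
  by rewrite /signed => /eqP ->; rewrite ffunE /=; case: ifP; lia.
Qed.

(** For point masses every offset is either prescribed or a signed label, so the
    inner sum over walks counts closed walks with given steps. *)
Lemma walk_sum_point_mass (w : nat -> int -> R[i]) (a : nat -> int) n :
  (forall j, (j < K)%N -> ~~ rnd j -> w j = point_mass (a j)) ->
  walk_sum w n = \sum_(neg : {ffun S -> bool}) scaling R S n *
    \sum_(m : {ffun S -> 'I_n}) ((reduced neg m)%:R *
        En n (fun s => signed (neg s) (m s))) *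
      \sum_(b < n) [forall i, 0 <= @walk_forms K flip
        (step_of a neg (fun s => m s)) n%:Z (b : nat)%:Z i]%:R.
Proof.
move=> hw; rewrite /walk_sum -mulr_sumr; congr (_ * _).
have hterm (k : {ffun 'I_K.+1 -> 'I_n}) :
  (\prod_(j < K | ~~ rnd j) w j (offset flip k j)) *
    En n (fun s : S => offset flip k (val s)) =
  \sum_(neg : {ffun S -> bool}) \sum_(m : {ffun S -> 'I_n})
   ((reduced neg m)%:R * En n (fun s => signed (neg s) (m s))) *
   [forall j : 'I_K, offset flip k j == step_of a neg (fun s => m s) j]%:R.
  rewrite (sum_signed_offsets k) mulr_sumr; apply: eq_bigr => neg _.
  rewrite mulr_sumr big_mkcond; apply: eq_bigr => m _ /=.
  case: (reduced neg m); last by rewrite !mul0r.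
  rewrite mul1r /=.
  have -> : \prod_(j < K | ~~ rnd j) w j (offset flip k j) =
      [forall j : 'I_K, ~~ rnd j ==> (offset flip k j == a j)]%:R.
    case: forallP => [h|/forallP/forallPn[j]].
      by rewrite big1// => j rj; rewrite hw// /point_mass (implyP (h j)).
    rewrite negb_imply => /andP[rj /negbTE h].
    by rewrite (bigD1 j)//= hw// /point_mass h mul0r.
  case: forallP => h1; last first.
    rewrite (_ : [forall j, _] = false) ?mulr0//; apply/negP => /forallP h.
    by apply: h1 => s; rewrite (eqP (h (val s))) step_of_rnd.
  rewrite mulrC; congr (_ * _%:R); congr nat_of_bool.
  apply/forallP/forallP => h j.
    have [rj|rj] := boolP (rnd j); last by rewrite step_of_det// (implyP (h j)).
    by have := h1 (exist _ j rj); rewrite -(step_of_rnd a neg (fun s => m s)).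
  by apply/implyP => rj; have := h j; rewrite step_of_det.
under eq_bigr do rewrite hterm.
rewrite exchange_big; apply: eq_bigr => neg _.
rewrite exchange_big; apply: eq_bigr => m _ /=.
rewrite -mulr_sumr; congr (_ * _).
rewrite -!natr_sum; congr (_%:R).
transitivity #|[pred k : {ffun 'I_K.+1 -> 'I_n} |
    closed_walk flip k (step_of a neg (fun s => m s))]|.
  by rewrite -sum1_card big_mkcond [RHS]big_mkcond; apply: eq_bigr => k _;
     rewrite inE /closed_walk; case: (k ord0 == _); case: [forall _, _].
rewrite count_closed_walks -sum1_card big_mkcond; apply: eq_bigr => b _.
by rewrite inE; case: [forall _, _].
Qed.

Let bound : R := C * #|{ffun S -> S}|%:R * #|{ffun S -> bool}|%:R.

Lemma walk_sum_point_mass_bound w a n : (0 < n)%N ->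
  (forall j, (j < K)%N -> ~~ rnd j -> w j = point_mass (a j)) ->
  cabs (walk_sum w n) <= bound.
Proof.
move=> n0 hw; rewrite (walk_sum_point_mass _ hw).
apply: le_trans (cabs_sum _ _ _) _.
rewrite /bound [leRHS]mulr_natr -sumr_const; apply: ler_sum => neg _.
apply: (labelling_sum_bound (col := col)) => // m.
  rewrite !cabsM; apply: ler_pM; rewrite ?mulr_ge0 ?cabs_ge0//.
    have hE : cabs (En n (fun s => signed (neg s) (m s))) <= C.
      apply: En_bounded => // s; have := ltn_ord (m s).
      by rewrite /signed; case: (neg s); lia.
    by case: (reduced _ _); rewrite ?cabs1 ?cabs0 ?mul1r ?mul0r.
  exact: cabs_sum_indicator.
by move=> hm; rewrite En_singleton// mulr0 mul0r.
Qed.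

Lemma walk_sum_point_mass_cauchy w a :
  (forall j, (j < K)%N -> ~~ rnd j -> w j = point_mass (a j)) ->
  cauchy_sequence (walk_sum w).
Proof.
move=> hw; apply: eq_cauchy (fun n _ => esym (walk_sum_point_mass n hw)) _.
apply: cauchy_sum => neg.
have [kappa hk] := En_pairing neg.
pose st (j : nat) (u : option S -> nat) : int := step_of a neg (u \o Some) j.
have hst j : affine_form (fun _ u => st j u).
  rewrite /st /step_of; case: pickP => [s _|_]; last exact: affine_cst.
  rewrite /signed; case: (neg s); last exact: affine_var.
  by apply: affineN; exact: affine_var.
have := @labelling_sum_cauchy R S I col _
  (fun i n u => @walk_forms K flip (st ^~ u) n%:Z (u None)%:Z i)
  (fun f => [forall i, f i])
  (fun n m => (reduced neg m)%:R * En n (fun s => signed (neg s) (m s)))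
  C kappa.
have hL i := @affine_walk_forms K flip _ st None i hst.
move=> /(_ hL C_ge0) H.
refine (eq_cauchy _ (H _ _ _)).
- move=> n n0; congr (_ * _); apply: eq_bigr => m _; congr (_ * _).
  apply: eq_bigr => b _; congr ((nat_of_bool _)%:R).
  by apply: eq_forallb => i; rewrite ffunE.
- move=> n m n0.
  have hE : cabs (En n (fun s => signed (neg s) (m s))) <= C.
    apply: En_bounded => // s; have := ltn_ord (m s).
    by rewrite /signed; case: (neg s); lia.
  by case: (reduced _ _); rewrite ?mul1r// mul0r cabs0.
- by move=> n m hm; rewrite En_singleton// mulr0.
- move=> n m n0 m0 hm; rewrite hk// (_ : reduced _ _) ?mul1r//.
  by apply/forallP => s; rewrite m0 implybT.
Qed.

Definition replace (w : nat -> int -> R[i]) (j : nat) (f : int -> R[i]) :=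
  fun i => if i == j then f else w i.

(** The two constructors of [int] as one function of a sign: contrary to [signed]
    it is a bijection, so an offset is decomposed without a special case at
    zero. *)
Definition int_of (neg : bool) (m : nat) : int := if neg then Negz m else Posz m.

Lemma walk_sum_expand w j n : (j < K)%N -> ~~ rnd j ->
  walk_sum w n = \sum_(neg : bool) \sum_(m < n) w j (int_of neg m) *
    walk_sum (replace w j (point_mass (int_of neg m))) n.
Proof.
move=> jK rj; rewrite /walk_sum.
under [RHS]eq_bigr do under eq_bigr do rewrite mulrCA mulr_sumr.
under [RHS]eq_bigr do rewrite -mulr_sumr exchange_big /=.
rewrite -mulr_sumr exchange_big /=; congr (_ * _); apply: eq_bigr => k _.
pose jo := Ordinal jK.
rewrite (bigD1 jo)//=.
have hp neg m : \prod_(i < K | ~~ rnd i)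
    replace w j (point_mass (int_of neg m)) i (offset flip k i) =
    (offset flip k j == int_of neg m)%:R *
    \prod_(i < K | ~~ rnd i && (i != jo)) w i (offset flip k i).
  rewrite (bigD1 jo)//= {1}/replace eqxx; congr (_ * _).
  by apply: eq_bigr => i /andP[_ ij]; rewrite /replace; case: eqP => // e;
     case/eqP: ij; apply: val_inj.
under [RHS]eq_bigr do under eq_bigr do rewrite hp !mulrA.
under [RHS]eq_bigr do rewrite -!mulr_suml.
rewrite -!mulr_suml; congr (_ * _ * _).
have hlt := offset_lt flip k j.
have pick neg (m : 'I_n) : offset flip k j = int_of neg m ->
    w j (offset flip k j) = \sum_b \sum_(i < n)
      w j (int_of b i) * (offset flip k j == int_of b i)%:R.
  move=> e; rewrite (bigD1 neg)//= (bigD1 m)//= -e eqxx mulr1 !big1 ?addr0//.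
    move=> b bneg; rewrite big1// => i _; case: eqP => [|_]; last by rewrite mulr0.
    by rewrite e; case: (b) (neg) bneg => -[].
  move=> i im; case: eqP => [|_]; last by rewrite mulr0.
  by rewrite e; case: (neg) => /= -[/val_inj mi]; rewrite mi eqxx in im.
case e: (offset flip k j) hlt => [p|p] hlt.
  by rewrite -e; apply: (pick false (Ordinal hlt)).
by rewrite -e; apply: (pick true (Ordinal (ltnW hlt))).
Qed.

Definition summable_by (f : int -> R[i]) (D : R) : Prop :=
  forall r : seq int, uniq r -> \sum_(i <- r) cabs (f i) <= D.

Lemma int_of_inj neg : injective (int_of neg).
Proof. by case: neg => i j []. Qed.

Lemma summable_by_half f D neg : summable_by f D ->
  forall N, \sum_(i < N) cabs (f (int_of neg i)) <= D.
Proof.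
move=> h N; have := h [seq int_of neg i | i <- iota 0 N].
rewrite map_inj_uniq ?iota_uniq ?big_map; last exact: int_of_inj.
move=> /(_ isT); rewrite -(big_mkord xpredT (fun i => cabs (f (int_of neg i)))).
by rewrite /index_iota subn0.
Qed.

(** The weights are replaced by point masses one letter at a time; at each
    stage both the convergence and a bound that is linear in the weight are
    carried along, as the next dominated convergence needs them. *)
Lemma walk_sum_partial (l : seq nat) (w : nat -> int -> R[i]) (D : nat -> R) :
  (forall j, (j < K)%N -> ~~ rnd j -> j \notin l -> exists a, w j = point_mass a) ->
  (forall j, j \in l -> (j < K)%N && ~~ rnd j) -> uniq l ->
  (forall j, j \in l -> summable_by (w j) (D j)) ->
  cauchy_sequence (walk_sum w) /\
  forall n, (0 < n)%N -> cabs (walk_sum w n) <= bound * \prod_(j <- l) (2 * D j).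
Proof.
elim: l w => [|j l IH] w hp hl ul hs.
  have [a ha] : exists a : nat -> int,
      forall j, (j < K)%N -> ~~ rnd j -> w j = point_mass (a j).
    have h j : exists a, (j < K)%N -> ~~ rnd j -> w j = point_mass a.
      have [/andP[jK rj]|] := boolP ((j < K)%N && ~~ rnd j).
        by have [a] := hp j jK rj isT; exists a.
      by move=> /negP h; exists 0 => jK rj; case: h; rewrite jK.
    by have [a ha] := boolp.choice h; exists a.
  split; first exact: walk_sum_point_mass_cauchy ha.
  by move=> n n0; rewrite big_nil mulr1; exact: walk_sum_point_mass_bound ha.
move: ul => /= /andP[jl ul].
have /andP[jK rj] := hl j (mem_head _ _).
have hsj : summable_by (w j) (D j) by apply: hs; exact: mem_head.
have sub i : i \in l -> i \in j :: l by move=> h; rewrite inE h orbT.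
have hrep b : cauchy_sequence (walk_sum (replace w j (point_mass b))) /\
    forall n, (0 < n)%N -> cabs (walk_sum (replace w j (point_mass b)) n) <=
      bound * \prod_(j <- l) (2 * D j).
  apply: IH => //; last 2 first.
  - by move=> i il; exact/hl/sub.
  - move=> i il; rewrite /replace; case: eqP => [ij|_]; last exact/hs/sub.
    by rewrite -ij il in jl.
  move=> i iK ri il; rewrite /replace; case: eqP => [_|/eqP ij]; first by exists b.
  by apply: hp; rewrite // inE negb_or ij.
pose B := bound * \prod_(j <- l) (2 * D j).
have D0 i : i \in j :: l -> 0 <= D i.
  by move=> /hs /(_ [::] isT); rewrite big_nil.
have B0 : 0 <= B.
  rewrite /B mulr_ge0 ?mulr_ge0// big_seq prodr_ge0// => i il.
  by rewrite mulr_ge0// D0// sub.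
have half neg := summable_by_half neg hsj.
split.
  have -> : walk_sum w = fun n => \sum_(neg : bool) \sum_(m < n)
      w j (int_of neg m) * walk_sum (replace w j (point_mass (int_of neg m))) n.
    by apply/funext => n; exact: walk_sum_expand.
  apply: cauchy_sum => neg.
  apply: (tannery (f := fun m => w j (int_of neg m))
    (c := fun n m => walk_sum (replace w j (point_mass (int_of neg m))) n) B0 (half neg)).
    by move=> m; apply: (hrep _).1.
  by move=> n m n0; apply: (hrep _).2.
move=> n n0; rewrite (walk_sum_expand _ _ jK rj) big_cons.
apply: le_trans (cabs_sum _ _ _) _.
have -> : bound * (2 * D j * \prod_(i <- l) (2 * D i)) = \sum_(neg : bool) D j * B.
  by rewrite sumr_const card_bool /B; ring.
apply: ler_sum => neg _; apply: le_trans (cabs_sum _ _ _) _.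
apply: (@le_trans _ _ (\sum_(m < n) cabs (w j (int_of neg m)) * B)).
  by apply: ler_sum => m _; rewrite cabsM ler_wpM2l ?cabs_ge0// (hrep _).2.
by rewrite -mulr_suml ler_wpM2r.
Qed.

Lemma walk_sum_cauchy (w : nat -> int -> R[i]) :
  (forall j, (j < K)%N -> ~~ rnd j -> exists D, summable_by (w j) D) ->
  cauchy_sequence (walk_sum w).
Proof.
move=> hw.
have [D hD] : exists D : nat -> R, forall j, (j < K)%N -> ~~ rnd j ->
    summable_by (w j) (D j).
  have h j : exists D, (j < K)%N -> ~~ rnd j -> summable_by (w j) D.
    have [/andP[jK rj]|] := boolP ((j < K)%N && ~~ rnd j).
      by have [D] := hw j jK rj; exists D.
    by move=> /negP h; exists 0 => jK rj; case: h; rewrite jK.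
  by have [D hD] := boolp.choice h; exists D.
apply: (walk_sum_partial (l := [seq j <- iota 0 K | ~~ rnd j]) (D := D) _ _ _ _).1.
- by move=> j jK rj; rewrite mem_filter rj mem_iota /= add0n jK.
- by move=> j; rewrite mem_filter mem_iota add0n /= andbC.
- by rewrite filter_uniq// iota_uniq.
- move=> j; rewrite mem_filter mem_iota add0n /= => /andP[rj jK]; exact: hD.
Qed.
End walk_sums.

(** * Comparison of weighted laws *)

Section weighted_transfer.
Local Open Scope ereal_scope.
Context (R : realType) d (Om : measurableType d) (mu : {measure set Om -> \bar R}).
Context dT (T : measurableType dT).

Import HBNNSimple.

Lemma integral_weighted_nnsfun (g : Om -> R) (X : Om -> T) (h : {nnsfun T >-> R}) :
  measurable_fun setT g -> (forall w, 0 <= g w)%R -> measurable_fun setT X ->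
  \int[mu]_w (g w * h (X w))%:E = \sum_(k \in range h)
    (k%:E * \int[mu]_w (g w * \1_(h @^-1` [set k]) (X w))%:E).
Proof.
move=> mg g0 mX.
have mi k : measurable_fun setT (fun w => (g w * \1_(h @^-1` [set k]) (X w))%R).
  apply: measurable_funM => //.
  by apply: (measurableT_comp _ mX); exact: measurable_indic.
transitivity (\int[mu]_w \sum_(k \in range h)
    (k * (g w * \1_(h @^-1` [set k]) (X w)))%:E).
  apply: eq_integral => w _; rewrite fsumEFin//; congr EFin.
  rewrite {1}fimfunE mulr_fsumr.
  by apply: eq_fsbigr => k _; rewrite mulrCA.
rewrite ge0_integral_fsum//; last 2 first.
- by move=> k; apply/measurable_EFinP; exact: measurable_funM.
- move=> k w _; rewrite mulrCA lee_fin mulr_ge0//.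
  by have := nnfun_muleindic_ge0 h k (X w); rewrite lee_fin.
apply: eq_fsbigr => k /[!inE] -[t _ <-].
rewrite -ge0_integralZl_EFin//.
- by move=> w _; rewrite lee_fin mulr_ge0.
- exact/measurable_EFinP.
Qed.

(** Two weighted laws that agree on events agree on all non-negative
    functions. This is used both for random variables with the same law and
    for replacing, in a product over an independent family, one indicator by a
    general function. *)
Lemma weighted_transfer (g g' : Om -> R) (X X' : Om -> T) :
  measurable_fun setT g -> (forall w, 0 <= g w)%R ->
  measurable_fun setT g' -> (forall w, 0 <= g' w)%R ->
  measurable_fun setT X -> measurable_fun setT X' ->
  (forall B, measurable B ->
    \int[mu]_w (g w * \1_B (X w))%:E = \int[mu]_w (g' w * \1_B (X' w))%:E) ->
  forall f : T -> R, measurable_fun setT f -> (forall t, 0 <= f t)%R ->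
    \int[mu]_w (g w * f (X w))%:E = \int[mu]_w (g' w * f (X' w))%:E.
Proof.
move=> mg g0 mg' g0' mX mX' hB f mf f0.
have mEf : measurable_fun setT (EFin \o f) by exact/measurable_EFinP.
pose h := nnsfun_approx measurableT mEf.
have lim (k : Om -> R) (Z : Om -> T) : measurable_fun setT k ->
    (forall w, 0 <= k w)%R -> measurable_fun setT Z ->
    \int[mu]_w (k w * f (Z w))%:E = limn (fun n => \int[mu]_w (k w * h n (Z w))%:E).
  move=> mk k0 mZ; rewrite -monotone_convergence//.
  - apply: eq_integral => w _; apply/esym/cvg_lim => //.
    under eq_fun do rewrite EFinM.
    rewrite EFinM; apply: cvgeZl => //.
    by apply: (@cvg_nnsfun_approx _ _ _ _ measurableT _ mEf) => // t _; rewrite lee_fin.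
  - move=> n; apply/measurable_EFinP; apply: measurable_funM => //.
    exact: measurableT_comp.
  - by move=> n w _; rewrite lee_fin mulr_ge0.
  - move=> w _ m n mn; rewrite lee_fin ler_wpM2l//.
    exact/lefP/nd_nnsfun_approx.
rewrite !lim//; congr (limn _); apply/funext => n.
rewrite !integral_weighted_nnsfun//; apply: eq_fsbigr => k _.
by rewrite hB//; exact: measurable_funP.
Qed.
End weighted_transfer.

(** * Complex expectations and independence *)

Section complex_expectation.
Context (R : realType) d (Om : measurableType d) (P : probability Om R).
Implicit Types Z : Om -> R[i].

Definition cmeasurable d' (T : measurableType d') (Z : T -> R[i]) : Prop :=
  measurable_fun setT (fun w => complex.Re (Z w)) /\
  measurable_fun setT (fun w => complex.Im (Z w)).

Definition cintegrable Z : Prop :=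
  P.-integrable setT (fun w => (complex.Re (Z w))%:E) /\
  P.-integrable setT (fun w => (complex.Im (Z w))%:E).

Lemma cexpectationE Z : cexpectation P Z =
  (\int[P]_w complex.Re (Z w)) +i* (\int[P]_w complex.Im (Z w)).
Proof. by rewrite /cexpectation !unlock. Qed.

Lemma cintegrableD Z1 Z2 : cintegrable Z1 -> cintegrable Z2 ->
  cintegrable (fun w => Z1 w + Z2 w).
Proof.
move=> [a1 b1] [a2 b2]; split.
  by rewrite (_ : (fun w => _) = (fun w => (complex.Re (Z1 w))%:E) \+
    (fun w => (complex.Re (Z2 w))%:E))%E; [exact: integrableD|
    apply/funext => w /=; rewrite raddfD].
by rewrite (_ : (fun w => _) = (fun w => (complex.Im (Z1 w))%:E) \+
    (fun w => (complex.Im (Z2 w))%:E))%E; [exact: integrableD|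
    apply/funext => w /=; rewrite raddfD].
Qed.

Lemma complex_ReM (z1 z2 : R[i]) : complex.Re (z1 * z2) =
  complex.Re z1 * complex.Re z2 - complex.Im z1 * complex.Im z2.
Proof. by case: z1 z2 => a b [c e]. Qed.

Lemma complex_ImM (z1 z2 : R[i]) : complex.Im (z1 * z2) =
  complex.Re z1 * complex.Im z2 + complex.Im z1 * complex.Re z2.
Proof. by case: z1 z2 => a b [c e]. Qed.

Lemma cintegrableZ c Z : cintegrable Z -> cintegrable (fun w => c * Z w).
Proof.
move=> [a b]; split.
  have -> : (fun w => (complex.Re (c * Z w))%:E) =
      ((fun w => (complex.Re c)%:E * (complex.Re (Z w))%:E) \-
       (fun w => (complex.Im c)%:E * (complex.Im (Z w))%:E))%E.
    by apply/funext => w; rewrite complex_ReM.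
  by apply: integrableB => //; exact: integrableZl.
have -> : (fun w => (complex.Im (c * Z w))%:E) =
      ((fun w => (complex.Re c)%:E * (complex.Im (Z w))%:E) \+
       (fun w => (complex.Im c)%:E * (complex.Re (Z w))%:E))%E.
    by apply/funext => w; rewrite complex_ImM.
by apply: integrableD => //; exact: integrableZl.
Qed.

Lemma cexpectationD Z1 Z2 : cintegrable Z1 -> cintegrable Z2 ->
  cexpectation P (fun w => Z1 w + Z2 w) = cexpectation P Z1 + cexpectation P Z2.
Proof.
move=> [a1 b1] [a2 b2]; rewrite !cexpectationE.
under eq_Rintegral do rewrite raddfD.
rewrite RintegralD//=.
under [X in _ +i* X]eq_Rintegral do rewrite raddfD.
by rewrite RintegralD.
Qed.

Lemma integrableZ_EFin (r : R) (f : Om -> R) :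
  P.-integrable setT (fun w => (f w)%:E) ->
  P.-integrable setT (EFin \o (fun w => r * f w)).
Proof.
move=> h; have -> : EFin \o (fun w => r * f w) = (fun w => r%:E * (f w)%:E)%E.
  by apply/funext => w /=; rewrite EFinM.
exact: integrableZl.
Qed.

Lemma cexpectationZ c Z : cintegrable Z ->
  cexpectation P (fun w => c * Z w) = c * cexpectation P Z.
Proof.
move=> [a b]; rewrite !cexpectationE.
under eq_Rintegral do rewrite complex_ReM.
rewrite RintegralB//; [|exact: integrableZ_EFin..].
under [X in _ +i* X]eq_Rintegral do rewrite complex_ImM.
rewrite RintegralD//; [|exact: integrableZ_EFin..].
rewrite !RintegralZl//.
by case: c => u v; rewrite [RHS]/GRing.mul /=.
Qed.

Lemma cintegrable0 : cintegrable (fun _ => 0).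
Proof. by split; exact: integrable0. Qed.

Lemma Rintegral_zero : \int[P]_w (0 : R) = 0.
Proof. by rewrite /Rintegral integral0. Qed.

Lemma cexpectation0 : cexpectation P (fun _ => 0) = 0.
Proof. by rewrite cexpectationE; congr (_ +i* _); exact: Rintegral_zero. Qed.

Lemma cintegrable_sum (J : Type) (s : seq J) (Q : pred J) (Z : J -> Om -> R[i]) :
  (forall j, Q j -> cintegrable (Z j)) ->
  cintegrable (fun w => \sum_(j <- s | Q j) Z j w).
Proof.
move=> h; elim: s => [|j s IH].
  rewrite (_ : (fun w => _) = (fun _ => 0)); first exact: cintegrable0.
  by apply/funext => w; exact: big_nil.
rewrite (_ : (fun w => _) = (fun w => if Q j
    then Z j w + \sum_(i <- s | Q i) Z i w else \sum_(i <- s | Q i) Z i w)).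
  by case hj : (Q j) => //; exact: cintegrableD (h _ hj) IH.
by apply/funext => w; exact: big_cons.
Qed.

Lemma cexpectation_sum (J : Type) (s : seq J) (Q : pred J) (Z : J -> Om -> R[i]) :
  (forall j, Q j -> cintegrable (Z j)) ->
  cexpectation P (fun w => \sum_(j <- s | Q j) Z j w) =
  \sum_(j <- s | Q j) cexpectation P (Z j).
Proof.
move=> h; elim: s => [|j s IH].
  rewrite (_ : (fun w => _) = (fun _ => 0)); first by rewrite big_nil cexpectation0.
  by apply/funext => w; exact: big_nil.
rewrite (_ : (fun w => _) = (fun w => if Q j
    then Z j w + \sum_(i <- s | Q i) Z i w else \sum_(i <- s | Q i) Z i w)).
  rewrite big_cons; case hj : (Q j) => //.
  by rewrite cexpectationD ?IH//; [exact: h|exact: cintegrable_sum].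
by apply/funext => w; exact: big_cons.
Qed.

(** A complex number is a combination with coefficients in [{1, -1, 'i, - 'i}] of
    four non-negative reals; this reduces products of complex variables to
    products of non-negative ones, whose integrals always make sense. *)
Definition nonneg_part (q : bool * bool) (z : R[i]) : R :=
  let x := if q.1 then complex.Im z else complex.Re z in
  Num.max (if q.2 then - x else x) 0.

Definition part_coef (q : bool * bool) : R[i] :=
  (if q.2 then -1 else 1) * (if q.1 then 'i else 1).

Lemma nonneg_part_ge0 q z : 0 <= nonneg_part q z.
Proof. by rewrite /nonneg_part le_max lexx orbT. Qed.

Lemma sum_nonneg_parts z : z = \sum_q part_coef q * (nonneg_part q z)%:C.
Proof.
rewrite -(pair_bigA _ (fun b c => part_coef (b, c) * (nonneg_part (b, c) z)%:C)).
rewrite !big_bool /part_coef /nonneg_part /=.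
case: z => a b /=.
have h (x : R) : x = Num.max x 0 - Num.max (- x) 0.
  have [x0|x0] := lerP 0 x.
    have x1 : - x <= 0 by rewrite oppr_le0.
    by rewrite (max_r x1) subr0.
  have x1 : 0 <= - x by rewrite oppr_ge0 ltW.
  by rewrite (max_l x1) sub0r opprK.
rewrite {1}(h a) {1}(h b); apply/eqP; rewrite eq_complex /=.
by apply/andP; split; apply/eqP; simpc => /=; lra.
Qed.

Lemma nonneg_part_le q z : nonneg_part q z <=
  if q.1 then `|complex.Im z| else `|complex.Re z|.
Proof.
rewrite /nonneg_part; case: q => -[] [] /=; rewrite ge_max normr_ge0 andbT.
all: by rewrite ?ler_norm// -normrN ler_norm.
Qed.

Lemma measurable_nonneg_part d' (T : measurableType d') (Z : T -> R[i]) q :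
  cmeasurable Z -> measurable_fun setT (fun w => nonneg_part q (Z w)).
Proof.
move=> [a b]; rewrite /nonneg_part.
apply: measurable_maxr => //; case: q => -[] [] //=; exact: measurable_funN.
Qed.

Lemma integrable_nonneg_part Z q : cintegrable Z ->
  P.-integrable setT (fun w => (nonneg_part q (Z w))%:E).
Proof.
move=> [a b].
have mZ : cmeasurable Z.
  by split; apply/measurable_EFinP; [case/integrableP: a|case/integrableP: b].
have hm : measurable_fun setT (fun w => (nonneg_part q (Z w))%:E).
  by apply/measurable_EFinP; exact: measurable_nonneg_part.
have h w := nonneg_part_le q (Z w).
case q1 : (q.1) h => h; [apply: le_integrable b|apply: le_integrable a] => //;
  move=> w _; rewrite lee_fin ger0_norm ?nonneg_part_ge0//; exact: h.
Qed.

Lemma cintegrable_real (f : Om -> R) :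
  P.-integrable setT (fun w => (f w)%:E) -> cintegrable (fun w => (f w)%:C).
Proof. by move=> hf; split => //; exact: integrable0. Qed.

Lemma cexpectation_real (f : Om -> R) :
  cexpectation P (fun w => (f w)%:C) = (\int[P]_w f w)%:C.
Proof. by rewrite cexpectationE; congr (_ +i* _); exact: Rintegral_zero. Qed.

Lemma cintegrable_of_parts Z :
  (forall q, P.-integrable setT (fun w => (nonneg_part q (Z w))%:E)) ->
  cintegrable Z.
Proof.
move=> h; rewrite (_ : Z = fun w => \sum_q part_coef q * (nonneg_part q (Z w))%:C).
  by apply: cintegrable_sum => q _; apply: cintegrableZ; exact: cintegrable_real.
by apply/funext => w; exact: sum_nonneg_parts.
Qed.

Lemma cexpectation_parts Z : cintegrable Z -> cexpectation P Z =
  \sum_q part_coef q * (\int[P]_w nonneg_part q (Z w))%:C.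
Proof.
move=> hZ.
have hq q : cintegrable (fun w => part_coef q * (nonneg_part q (Z w))%:C).
  by apply: cintegrableZ; apply: cintegrable_real; exact: integrable_nonneg_part.
rewrite {1}(_ : Z = fun w => \sum_q part_coef q * (nonneg_part q (Z w))%:C); last first.
  by apply/funext => w; exact: sum_nonneg_parts.
rewrite cexpectation_sum//; apply: eq_bigr => q _.
rewrite cexpectationZ ?cexpectation_real//.
by apply: cintegrable_real; exact: integrable_nonneg_part.
Qed.
End complex_expectation.

Section independence.
Context (R : realType) d (Om : measurableType d) (P : probability Om R).
Context dT (T : measurableType dT).

Definition independent_family (J : finType) (X : J -> Om -> T) : Prop :=
  forall B : J -> set T, (forall j, measurable (B j)) ->
    P [set w | forall j, B j (X j w)] = (\prod_j P (X j @^-1` B j))%E.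

(** A finite subfamily; the events of the other indices are taken to be the
    whole space. *)
Lemma mutually_independent_family (I : choiceType) (J : finType) (e : J -> I)
    (X : I -> Om -> T) : injective e -> mutually_independent P X ->
  independent_family (fun j => X (e j)).
Proof.
move=> inj hX B mB.
pose B' (i : I) : set T := if [pick j | e j == i] is Some j then B j else setT.
have B'E j : B' (e j) = B j.
  rewrite /B'; case: pickP => [k /eqP /inj -> //|/(_ j)]; by rewrite eqxx.
have mB' i : measurable (B' i) by rewrite /B'; case: pickP.
have := hX [fset e j | j in J]%fset B' mB'.
rewrite (perm_big (map e (enum J))) /=; last first.
  apply: uniq_perm => //; first by rewrite map_inj_uniq ?enum_uniq.
  move=> i; apply/imfsetP/mapP => -[j hj ->]; exists j => //.
  by rewrite mem_enum.
rewrite big_map big_enum /= => h; transitivity (\prod_j P (X (e j) @^-1` B' (e j)))%E.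
  rewrite -h; congr (P _); apply/seteqP; split => w /=.
    by move=> hw i /= /imfsetP[j _ ->]; rewrite /= B'E.
  by move=> hw j; rewrite -B'E; apply: hw; apply/imfsetP; exists j.
by apply: eq_bigr => j _; rewrite B'E.
Qed.

Section family.
Variables (J : finType) (X : J -> Om -> T).
Hypothesis mX : forall j, measurable_fun setT (X j).
Hypothesis indep : independent_family X.

Lemma integral_prod_indic (f : J -> T -> R) :
  (forall j, exists B, measurable B /\ f j = \1_B) ->
  (\int[P]_w (\prod_j f j (X j w))%:E =
   (\prod_j \int[P]_w f j (X j w))%:E)%E.
Proof.
move=> /boolp.choice[B hB].
have mB j : measurable (B j) by case: (hB j).
have fB j : f j = \1_(B j) by case: (hB j).
have mXB j : measurable (X j @^-1` B j) by rewrite -[_ @^-1` _]setTI; exact: mX.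
pose A := [set w | forall j, B j (X j w)].
have AE : A = \bigcap_(j in [set: J]) (X j @^-1` B j).
  by apply/seteqP; split => w /= h j => [_|]; exact: h.
have mA : measurable A.
  rewrite AE; apply: fin_bigcap_measurable => //; exact: finite_finset.
transitivity (\int[P]_w (\1_A w)%:E)%E.
  apply: eq_integral => w _; congr EFin.
  have [wA|wA] := pselect (A w).
    rewrite indicE (mem_set wA) big1// => j _.
    by rewrite fB indicE (mem_set (wA j)).
  have [j hj] : exists j, ~ B j (X j w) by apply/existsNP.
  rewrite indicE (memNset wA) (bigD1 j)//= fB indicE (memNset hj).
  by rewrite mul0r.
rewrite integral_indic// setIT; apply: eq_trans (indep mB) _.
rewrite (big_morph EFin (@EFinM R) (erefl 1%:E)).
apply: eq_bigr => j _; rewrite fB.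
have -> : \int[P]_w \1_(B j) (X j w) = fine (P (X j @^-1` B j)).
  rewrite /Rintegral -[X in _ = fine (_ X)]setIT -integral_indic//.
rewrite fineK//; exact: fin_num_measure.
Qed.

(** The indicators of [integral_prod_indic] are replaced by general functions one
    index at a time, the other factors being frozen into a weight. *)
Lemma ge0_integral_prod (f : J -> T -> R) :
  (forall j, measurable_fun setT (f j)) -> (forall j t, 0 <= f j t) ->
  (forall j, P.-integrable setT (fun w => (f j (X j w))%:E)) ->
  (\int[P]_w (\prod_j f j (X j w))%:E =
   (\prod_j \int[P]_w f j (X j w))%:E)%E.
Proof.
suff H (l : seq J) : forall f : J -> T -> R,
  (forall j, j \notin l -> exists B, measurable B /\ f j = \1_B) ->
  (forall j, measurable_fun setT (f j)) -> (forall j t, 0 <= f j t) ->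
  (forall j, P.-integrable setT (fun w => (f j (X j w))%:E)) ->
  (\int[P]_w (\prod_j f j (X j w))%:E =
   (\prod_j \int[P]_w f j (X j w))%:E)%E.
  by apply: (H (enum J)) => j; rewrite mem_enum.
elim: l => [|i l IH] {}f hf mf f0 intf.
  by apply: integral_prod_indic => j; exact: hf.
pose g w := \prod_(j | j != i) f j (X j w).
pose K := \prod_(j | j != i) \int[P]_w f j (X j w).
have mfX j : measurable_fun setT (fun w => f j (X j w)) by exact: measurableT_comp.
have mg : measurable_fun setT g.
  rewrite /g; under boolp.eq_fun do rewrite -big_filter.
  by apply: measurable_prod => j _.
have g0 w : 0 <= g w by apply: prodr_ge0.
have K0 : 0 <= K by apply: prodr_ge0 => j _; apply: Rintegral_ge0.
have hB B : measurable B ->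
    (\int[P]_w (g w * \1_B (X i w))%:E = \int[P]_w (K * \1_B (X i w))%:E)%E.
  move=> mB.
  have mBX : measurable (X i @^-1` B) by rewrite -[_ @^-1` _]setTI; exact: mX.
  have iB : P.-integrable setT (fun w => (\1_B (X i w) : R)%:E).
    by rewrite (_ : (fun w => _) = EFin \o \1_(X i @^-1` B))//; exact: integrable_indic.
  pose f' j := if j == i then \1_B : T -> R else f j.
  have := IH f' _ _ _ _.
  rewrite /f'; under eq_integral do rewrite (bigD1 i)//= eqxx mulrC.
  rewrite (bigD1 i)//= eqxx.
  under eq_integral do under eq_bigr do rewrite ifN//.
  under eq_bigr do rewrite ifN//.
  rewrite -/K => ->.
  - under [RHS]eq_integral do rewrite EFinM.
    rewrite ge0_integralZl_EFin//.
    + by rewrite mulrC EFinM fineK// integrable_fin_num.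
    + by case/integrableP: iB.
  - move=> j jl; case: eqP => [_|/eqP ji]; first by exists B.
    by apply: hf; rewrite inE negb_or ji.
  - by move=> j; case: eqP.
  - by move=> j t; case: eqP.
  - by move=> j; case: eqP => // ->.
have := weighted_transfer mg g0 (measurable_cst K) (fun=> K0) (mX i) (mX i) hB (mf i) (f0 i).
under eq_integral do rewrite mulrC -(bigD1 i (P := predT) (F := fun j => f j (X j _)))//.
move=> ->; under eq_integral do rewrite EFinM.
rewrite ge0_integralZl_EFin//.
- by rewrite [in RHS](bigD1 i)//= mulrC EFinM fineK// integrable_fin_num.
- by move=> w _; rewrite lee_fin.
- by case/integrableP: (intf i).
Qed.

Lemma cexpectation_prod (f : J -> T -> R[i]) :
  (forall j, cmeasurable (f j)) ->
  (forall j, cintegrable P (fun w => f j (X j w))) ->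
  cintegrable P (fun w => \prod_j f j (X j w)) /\
  cexpectation P (fun w => \prod_j f j (X j w)) =
    \prod_j cexpectation P (fun w => f j (X j w)).
Proof.
move=> mf intf.
pose c (b : {ffun J -> bool * bool}) : R[i] := \prod_j part_coef R (b j).
pose F (b : {ffun J -> bool * bool}) w := \prod_j nonneg_part (b j) (f j (X j w)).
have expand w : \prod_j f j (X j w) = \sum_b c b * (F b w)%:C.
  under eq_bigr do rewrite [f _ _]sum_nonneg_parts.
  rewrite bigA_distr_bigA; apply: eq_bigr => b _.
  by rewrite big_split /= /F rmorph_prod.
have key (b : {ffun J -> bool * bool}) := ge0_integral_prod
  (f := fun j t => nonneg_part (b j) (f j t))
  (fun j => measurable_nonneg_part (b j) (mf j)) (fun j t => nonneg_part_ge0 _ _)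
  (fun j => integrable_nonneg_part (b j) (intf j)).
have iF b : P.-integrable setT (fun w => (F b w)%:E).
  apply/integrableP; split.
    apply/measurable_EFinP; rewrite /F; apply: measurable_prod => j _.
    apply: measurable_nonneg_part; case: (mf j) => m1 m2.
    by split; [apply: (measurableT_comp m1)|apply: (measurableT_comp m2)].
  rewrite (eq_integral (fun w => (F b w)%:E)) ?/F ?key ?ltry// => w _.
  by rewrite gee0_abs// lee_fin prodr_ge0// => j _; exact: nonneg_part_ge0.
split.
  under boolp.eq_fun do rewrite expand; apply: cintegrable_sum => b _.
  by apply: cintegrableZ; exact: cintegrable_real.
under boolp.eq_fun do rewrite expand.
rewrite cexpectation_sum; last first.
  by move=> b _; apply: cintegrableZ; exact: cintegrable_real.
under [RHS]eq_bigr do rewrite cexpectation_parts//.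
rewrite bigA_distr_bigA; apply: eq_bigr => b _.
rewrite cexpectationZ; last exact: cintegrable_real.
rewrite cexpectation_real big_split /= -rmorph_prod; congr (_ * _%:C).
by rewrite /Rintegral key.
Qed.
End family.

Lemma identically_distributed_cexpectation (X Y : Om -> T) (f : T -> R[i]) :
  measurable_fun setT X -> measurable_fun setT Y ->
  identically_distributed P X Y -> cmeasurable f ->
  cintegrable P (fun w => f (Y w)) ->
  cintegrable P (fun w => f (X w)) /\
  cexpectation P (fun w => f (X w)) = cexpectation P (fun w => f (Y w)).
Proof.
move=> mX mY hXY mf intf.
have key q : (\int[P]_w (nonneg_part q (f (X w)))%:E =
    \int[P]_w (nonneg_part q (f (Y w)))%:E)%E.
  have pre (Z : Om -> T) B : measurable_fun setT Z -> measurable B ->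
      measurable (Z @^-1` B).
    by move=> mZ mB; rewrite -[_ @^-1` _]setTI; exact: mZ.
  have e (k : Om -> R) : (\int[P]_w (cst 1 w * k w)%:E = \int[P]_w (k w)%:E)%E.
    by apply: eq_integral => w _; rewrite mul1r.
  rewrite -(e (fun w => nonneg_part q (f (X w)))) -(e (fun w => nonneg_part q (f (Y w)))).
  have hB B : measurable B -> (\int[P]_w (cst 1 w * \1_B (X w))%:E =
      \int[P]_w (cst 1 w * \1_B (Y w))%:E)%E.
    move=> mB; rewrite (e (fun w => \1_B (X w))) (e (fun w => \1_B (Y w))).
    have := hXY B mB; rewrite -[X @^-1` B]setIT -[Y @^-1` B]setIT.
    by rewrite -!integral_indic//; exact: pre.
  have m1 := @measurable_cst _ _ Om R setT 1.
  exact: (weighted_transfer m1 (fun=> ler01) m1 (fun=> ler01) mX mY hB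
    (measurable_nonneg_part q mf) (fun t => nonneg_part_ge0 q (f t))).
have iX : cintegrable P (fun w => f (X w)).
  apply: cintegrable_of_parts => q; apply/integrableP; split.
    apply/measurable_EFinP; apply: measurable_nonneg_part; case: mf => m1 m2.
    by split; [apply: (measurableT_comp m1)|apply: (measurableT_comp m2)].
  rewrite (eq_integral (fun w => (nonneg_part q (f (X w)))%:E)); last first.
    by move=> w _; rewrite gee0_abs// lee_fin nonneg_part_ge0.
  by rewrite key ltey_eq integrable_fin_num// integrable_nonneg_part.
split=> //; rewrite !cexpectation_parts//; apply: eq_bigr => q _.
by rewrite /Rintegral key.
Qed.
End independence.

(** * Families with bounded moments *)

Section moments.
Context (R : realType) d (Om : measurableType d) (P : probability Om R).

(** Equivalent to the modulus, and measurable without a square root. *)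
Definition abs1 (z : R[i]) : R := `|complex.Re z| + `|complex.Im z|.

Lemma abs1_ge0 z : 0 <= abs1 z.
Proof. by rewrite addr_ge0. Qed.

Lemma abs1D z1 z2 : abs1 (z1 + z2) <= abs1 z1 + abs1 z2.
Proof.
rewrite /abs1 !raddfD /= addrACA lerD//; exact: ler_normD.
Qed.

Lemma abs1M z1 z2 : abs1 (z1 * z2) <= abs1 z1 * abs1 z2.
Proof.
rewrite /abs1 complex_ReM complex_ImM.
have h1 := ler_normB (complex.Re z1 * complex.Re z2) (complex.Im z1 * complex.Im z2).
have h2 := ler_normD (complex.Re z1 * complex.Im z2) (complex.Im z1 * complex.Re z2).
by apply: le_trans (lerD h1 h2) _; rewrite !normrM le_eqVlt; apply/orP; left; apply/eqP; ring.
Qed.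

Lemma cmeasurableD d' (T : measurableType d') (Z1 Z2 : T -> R[i]) :
  cmeasurable Z1 -> cmeasurable Z2 -> cmeasurable (fun w => Z1 w + Z2 w).
Proof.
move=> [a1 b1] [a2 b2]; split.
  by under boolp.eq_fun do rewrite raddfD; exact: measurable_funD.
by under boolp.eq_fun do rewrite raddfD; exact: measurable_funD.
Qed.

Lemma cmeasurableM d' (T : measurableType d') (Z1 Z2 : T -> R[i]) :
  cmeasurable Z1 -> cmeasurable Z2 -> cmeasurable (fun w => Z1 w * Z2 w).
Proof.
move=> [a1 b1] [a2 b2]; split.
  under boolp.eq_fun do rewrite complex_ReM.
  by apply: measurable_funB; exact: measurable_funM.
under boolp.eq_fun do rewrite complex_ImM.
by apply: measurable_funD; exact: measurable_funM.
Qed.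

Lemma cmeasurable_cst d' (T : measurableType d') (z : R[i]) :
  cmeasurable (fun _ : T => z).
Proof. by split; exact: measurable_cst. Qed.

Lemma cmeasurable_prod d' (T : measurableType d') (J : Type) (s : seq J)
    (Q : pred J) (Z : J -> T -> R[i]) : (forall j, cmeasurable (Z j)) ->
  cmeasurable (fun t => \prod_(j <- s | Q j) Z j t).
Proof.
move=> h; elim: s => [|j s IH].
  rewrite (_ : (fun w => _) = (fun _ => 1)); first exact: cmeasurable_cst.
  by apply/funext => w; exact: big_nil.
rewrite (_ : (fun w => _) = (fun w => if Q j
    then Z j w * \prod_(i <- s | Q i) Z i w else \prod_(i <- s | Q i) Z i w)).
  by case: (Q j) => //; exact: cmeasurableM.
by apply/funext => w; exact: big_cons.
Qed.

(** All moments bounded uniformly over the index [A]; the families with this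
    property form an algebra, which avoids any explicit Hoelder estimate. *)
Definition moments_bounded (A : Type) (Z : A -> Om -> R[i]) : Prop :=
  (forall a, cmeasurable (Z a)) /\
  forall k, exists C : R, forall a, (\int[P]_w (abs1 (Z a w) ^+ k)%:E <= C%:E)%E.

Lemma measurable_abs1X Z k : cmeasurable Z ->
  measurable_fun [set: Om] (fun w => abs1 (Z w) ^+ k).
Proof.
move=> [a b]; apply: measurable_funX; apply: measurable_funD.
  exact: measurableT_comp.
exact: measurableT_comp.
Qed.

Lemma moments_bounded_le (A : Type) (Z Z1 Z2 : A -> Om -> R[i]) :
  moments_bounded Z1 -> moments_bounded Z2 -> (forall a, cmeasurable (Z a)) ->
  (forall k, exists (p q : nat) (K : R), 0 <= K /\ forall a w,
    abs1 (Z a w) ^+ k <= K * (abs1 (Z1 a w) ^+ p + abs1 (Z2 a w) ^+ q)) ->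
  moments_bounded Z.
Proof.
move=> [m1 h1] [m2 h2] mZ h; split=> // k.
have [p [q [K [K0 hK]]]] := h k.
have [C1 hC1] := h1 p; have [C2 hC2] := h2 q.
exists (K * (C1 + C2)) => a.
have ge0 (U : A -> Om -> R[i]) r w : [set: Om] w -> (0 <= (abs1 (U a w) ^+ r)%:E)%E.
  by move=> _; rewrite lee_fin exprn_ge0// abs1_ge0.
have mE (U : A -> Om -> R[i]) r : cmeasurable (U a) ->
    measurable_fun [set: Om] (fun w => (abs1 (U a w) ^+ r)%:E).
  by move=> mU; apply/measurable_EFinP; exact: measurable_abs1X.
apply: (@le_trans _ _ (\int[P]_w (K%:E *
    ((abs1 (Z1 a w) ^+ p)%:E + (abs1 (Z2 a w) ^+ q)%:E)))%E).
  apply: ge0_le_integral => //; [exact: ge0|exact: mE| | ].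
  - by apply: measurable_funeM; apply: emeasurable_funD; exact: mE.
  - by move=> w _; rewrite -EFinD -EFinM lee_fin; exact: hK.
have msum : measurable_fun [set: Om]
    (fun w => (abs1 (Z1 a w) ^+ p)%:E + (abs1 (Z2 a w) ^+ q)%:E)%E.
  by apply: emeasurable_funD; exact: mE.
rewrite (ge0_integralZl_EFin _ measurableT _ msum K0); last first.
  by move=> w wT; rewrite adde_ge0 ?ge0.
rewrite ge0_integralD//; last 4 first.
- exact: ge0.
- exact: mE.
- exact: ge0.
- exact: mE.
by rewrite EFinM lee_wpmul2l ?lee_fin// EFinD leeD.
Qed.

Lemma moments_boundedM (A : Type) (Z1 Z2 : A -> Om -> R[i]) :
  moments_bounded Z1 -> moments_bounded Z2 ->
  moments_bounded (fun a w => Z1 a w * Z2 a w).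
Proof.
move=> h1 h2; apply: (moments_bounded_le h1 h2).
  by move=> a; apply: cmeasurableM; [apply: h1.1|apply: h2.1].
move=> k; exists (k * 2)%N, (k * 2)%N, 1; split=> // a w; rewrite mul1r.
have x0 := abs1_ge0 (Z1 a w); have y0 := abs1_ge0 (Z2 a w).
apply: (@le_trans _ _ ((abs1 (Z1 a w) * abs1 (Z2 a w)) ^+ k)).
  by rewrite lerXn2r ?nnegrE ?abs1_ge0 ?mulr_ge0// abs1M.
rewrite exprMn !exprM; move: (abs1 _ ^+ k) (abs1 _ ^+ k) => x y.
by have := sqr_ge0 (x - y); have := sqr_ge0 (x + y); rewrite sqrrB sqrrD; lra.
Qed.

Lemma moments_boundedD (A : Type) (Z1 Z2 : A -> Om -> R[i]) :
  moments_bounded Z1 -> moments_bounded Z2 ->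
  moments_bounded (fun a w => Z1 a w + Z2 a w).
Proof.
move=> h1 h2; apply: (moments_bounded_le h1 h2).
  by move=> a; apply: cmeasurableD; [apply: h1.1|apply: h2.1].
move=> k; exists k, k, (2 ^+ k); split; first by rewrite exprn_ge0.
move=> a w; have x0 := abs1_ge0 (Z1 a w); have y0 := abs1_ge0 (Z2 a w).
apply: (@le_trans _ _ ((abs1 (Z1 a w) + abs1 (Z2 a w)) ^+ k)).
  by rewrite lerXn2r ?nnegrE ?abs1_ge0 ?addr_ge0// abs1D.
move: (abs1 _) (abs1 _) x0 y0 => x y x0 y0.
have gen (u v : R) : 0 <= u -> 0 <= v -> u <= v -> (u + v) ^+ k <= 2 ^+ k * (u ^+ k + v ^+ k).
  move=> u0 v0 uv; apply: (@le_trans _ _ ((2 * v) ^+ k)).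
    by apply: lerXn2r; rewrite ?nnegrE; lra.
  by rewrite exprMn ler_wpM2l ?exprn_ge0// lerDr exprn_ge0.
have [yx|/ltW xy] := lerP y x; first exact: gen.
by rewrite addrC [y ^+ k + _]addrC; exact: gen.
Qed.

Lemma moments_bounded_cst (A : Type) (z : R[i]) :
  moments_bounded (fun (_ : A) (_ : Om) => z).
Proof.
split=> [a|k]; first exact: cmeasurable_cst.
exists (abs1 z ^+ k) => a; rewrite integral_cst//= probability_setT.
by rewrite mule1.
Qed.

Lemma moments_bounded_prod (A J : Type) (s : seq J) (Q : pred J)
    (Z : J -> A -> Om -> R[i]) : (forall j, moments_bounded (Z j)) ->
  moments_bounded (fun a w => \prod_(j <- s | Q j) Z j a w).
Proof.
move=> h; elim: s => [|j s IH].
  rewrite (_ : (fun a w => _) = (fun _ _ => 1)); first exact: moments_bounded_cst.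
  by apply/funext => a; apply/funext => w; exact: big_nil.
rewrite (_ : (fun a w => _) = (fun a w => if Q j
    then Z j a w * \prod_(i <- s | Q i) Z i a w else \prod_(i <- s | Q i) Z i a w)).
  by case: (Q j) => //; exact: moments_boundedM.
by apply/funext => a; apply/funext => w; exact: big_cons.
Qed.

Lemma moments_bounded_reindex (A B : Type) (f : B -> A) (Z : A -> Om -> R[i]) :
  moments_bounded Z -> moments_bounded (fun b => Z (f b)).
Proof.
by move=> [m h]; split=> // k; have [C hC] := h k; exists C.
Qed.

Lemma moments_bounded_integrable (A : Type) (Z : A -> Om -> R[i]) :
  moments_bounded Z -> forall a, cintegrable P (Z a).
Proof.
move=> [m h] a; have [C hC] := h 1; have [m1 m2] := m a.
have gen (f : Om -> R) : measurable_fun setT f ->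
    (forall w, `|f w| <= abs1 (Z a w)) -> P.-integrable setT (fun w => (f w)%:E).
  move=> mf hf; apply/integrableP; split; first exact/measurable_EFinP.
  apply: le_lt_trans (ltry C); apply: le_trans (hC a).
  apply: ge0_le_integral => //.
  - by apply/measurable_EFinP; exact: measurableT_comp.
  - by apply/measurable_EFinP; apply: measurable_abs1X.
  - by move=> w _; rewrite lee_fin expr1.
split; apply: gen => // w; rewrite /abs1.
  by rewrite lerDl.
by rewrite lerDr.
Qed.

Lemma moments_bounded_expectation (A : Type) (Z : A -> Om -> R[i]) :
  moments_bounded Z -> exists C, forall a, cabs (cexpectation P (Z a)) <= C.
Proof.
move=> hZ; have hi := moments_bounded_integrable hZ.
have [m h] := hZ; have [C hC] := h 1; exists (C + C) => a.
have [i1 i2] := hi a; have [m1 m2] := m a.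
have gen (f : Om -> R) : P.-integrable setT (fun w => (f w)%:E) ->
    (forall w, `|f w| <= abs1 (Z a w)) -> `|\int[P]_w f w| <= C.
  move=> intf hf; rewrite -lee_fin EFin_normr_Rintegral//.
  have mf : measurable_fun setT (fun w => (f w)%:E) by case/integrableP: intf.
  apply: le_trans (le_abse_integral _ measurableT mf) _.
  apply: le_trans (hC a); apply: ge0_le_integral => //.
  - exact: measurableT_comp.
  - by apply/measurable_EFinP; apply: measurable_abs1X.
  - by move=> w _; rewrite lee_fin expr1.
rewrite cexpectationE; apply: le_trans (cabs_le_ReIm _) _ => /=.
by rewrite lerD//; apply: gen => // w; rewrite /abs1; [rewrite lerDl|rewrite lerDr].
Qed.
End moments.

(** * Covariances of the input *)

Section pair_correlation.
Context (R : realType) d (Om : measurableType d) (P : probability Om R).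
Variables (x y : nat -> int -> {RV P >-> R}).
Variables (sigmax sigmay rho1 rho2 rho3 rho4 rho5 rho6 : R).
Hypothesis hA :
  pair_correlated x y sigmax sigmay rho1 rho2 rho3 rho4 rho5 rho6.

Definition starc (star : bool) (z : R[i]) : R[i] :=
  if star then Num.conj z else z.

Definition input n (h : int) (w : Om) : R[i] := x n h w +i* y n h w.

(** The adjoint of a Toeplitz matrix is Toeplitz, with its diagonals reversed. *)
Definition diagonal_entry n (star : bool) (h : int) (w : Om) : R[i] :=
  starc star (input n (if star then - h else h) w).

Definition imaginary_unit (star : bool) : R[i] := if star then - 'i else 'i.

Lemma diagonal_entryE n star h w :
  diagonal_entry n star h w =
  (x n (if star then - h else h) w)%:C +
  imaginary_unit star * (y n (if star then - h else h) w)%:C.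
Proof.
rewrite /diagonal_entry /input /starc /imaginary_unit; case: star => /=;
  by apply/eqP; rewrite eq_complex /=; apply/andP; split; apply/eqP; ring.
Qed.

Lemma moments_bounded_real (z : nat -> int -> {RV P >-> R}) :
  (forall k, (0 < k)%N -> exists c : R, forall n j,
    ('E_P[fun w => (`|z n j w| ^+ k)%R] <= c%:E)%E) ->
  moments_bounded P (fun (p : nat * int) w => (z p.1 p.2 w)%:C).
Proof.
move=> hz; split=> [[n j]|k].
  by split; [exact: measurable_funP|exact: measurable_cst].
have aE p w : abs1 (z p.1 p.2 w)%:C = `|z p.1 p.2 w|.
  by rewrite /abs1 /= normr0 addr0.
have [->|k0] := posnP k.
  exists 1 => p; under eq_integral do rewrite expr0.
  by rewrite integral_cst//= probability_setT mule1.
have [c hc] := hz k k0; exists c => p; under eq_integral do rewrite aE.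
by have := hc p.1 p.2; rewrite unlock.
Qed.

Lemma moments_bounded_x :
  moments_bounded P (fun (p : nat * int) w => (x p.1 p.2 w)%:C).
Proof.
apply: moments_bounded_real => k k0; have [c hc] := pc_moments hA k0.
by exists c => n j; case: (hc n j).
Qed.

Lemma moments_bounded_y :
  moments_bounded P (fun (p : nat * int) w => (y p.1 p.2 w)%:C).
Proof.
apply: moments_bounded_real => k k0; have [c hc] := pc_moments hA k0.
by exists c => n j; case: (hc n j).
Qed.

Lemma moments_bounded_entry star :
  moments_bounded P (fun (p : nat * int) => diagonal_entry p.1 star p.2).
Proof.
rewrite (_ : (fun p => _) = fun p w => (x p.1 (if star then - p.2 else p.2) w)%:C +
  imaginary_unit star * (y p.1 (if star then - p.2 else p.2) w)%:C); last first.
  by apply/funext => p; apply/funext => w; exact: diagonal_entryE.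
pose f (p : nat * int) := (p.1, if star then - p.2 else p.2).
apply: moments_boundedD; first exact: (moments_bounded_reindex f moments_bounded_x).
apply: moments_boundedM; first exact: moments_bounded_cst.
exact: (moments_bounded_reindex f moments_bounded_y).
Qed.

Lemma integral_input n h :
  \int[P]_w x n h w = 0 /\ \int[P]_w y n h w = 0.
Proof.
by have := pc_mean hA n h; rewrite cexpectationE /= => -[-> ->].
Qed.

Lemma cexpectation_entry n star h : cexpectation P (diagonal_entry n star h) = 0.
Proof.
pose h' := if star then - h else h.
have -> : diagonal_entry n star h =
    fun w => (x n h' w)%:C + imaginary_unit star * (y n h' w)%:C.
  by apply/funext => w; exact: diagonal_entryE.
have ix := moments_bounded_integrable moments_bounded_x (n, h').
have iy := moments_bounded_integrable moments_bounded_y (n, h').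
rewrite cexpectationD//; last exact: cintegrableZ.
rewrite cexpectationZ// !cexpectation_real.
by have [-> ->] := integral_input n h'; rewrite mulr0 addr0.
Qed.

(** Covariances of the coordinates on the diagonals [signed b1 v] and
    [signed b2 v], where [true] stands for a negative diagonal. *)
Definition cov_xx (b1 b2 : bool) := if b1 == b2 then sigmax ^+ 2 else rho2.
Definition cov_yy (b1 b2 : bool) := if b1 == b2 then sigmay ^+ 2 else rho5.
Definition cov_xy (b1 b2 : bool) :=
  if b1 then (if b2 then rho6 else rho4) else (if b2 then rho3 else rho1).

Lemma integral_expectation (f : Om -> R) (r : R) :
  ('E_P[f] = r%:E)%E -> \int[P]_w f w = r.
Proof. by rewrite unlock /Rintegral => ->. Qed.

Lemma integral_xx n v b1 b2 : (0 < v)%N ->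
  \int[P]_w (x n (signed b1 v) w * x n (signed b2 v) w) = cov_xx b1 b2.
Proof.
move=> v0; have v1 : 1 <= v%:Z by lia.
rewrite /cov_xx /signed; case: b1 b2 => -[] /=.
- by apply: integral_expectation; rewrite -(pc_varx hA n (- v%:Z)).
- under eq_Rintegral do rewrite mulrC.
  by apply: integral_expectation; rewrite -(pc_rho2 hA n v1).
- by apply: integral_expectation; rewrite -(pc_rho2 hA n v1).
- by apply: integral_expectation; rewrite -(pc_varx hA n v%:Z).
Qed.

Lemma integral_yy n v b1 b2 : (0 < v)%N ->
  \int[P]_w (y n (signed b1 v) w * y n (signed b2 v) w) = cov_yy b1 b2.
Proof.
move=> v0; have v1 : 1 <= v%:Z by lia.
rewrite /cov_yy /signed; case: b1 b2 => -[] /=.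
- by apply: integral_expectation; rewrite -(pc_vary hA n (- v%:Z)).
- under eq_Rintegral do rewrite mulrC.
  by apply: integral_expectation; rewrite -(pc_rho5 hA n v1).
- by apply: integral_expectation; rewrite -(pc_rho5 hA n v1).
- by apply: integral_expectation; rewrite -(pc_vary hA n v%:Z).
Qed.

Lemma integral_xy n v b1 b2 : (0 < v)%N ->
  \int[P]_w (x n (signed b1 v) w * y n (signed b2 v) w) = cov_xy b1 b2.
Proof.
move=> v0; have v1 : 1 <= v%:Z by lia.
rewrite /cov_xy /signed; apply: integral_expectation; case: b1 b2 => -[] /=.
- exact: (pc_rho6 hA n v1).
- exact: (pc_rho4 hA n v1).
- exact: (pc_rho3 hA n v1).
- exact: (pc_rho1 hA n v1).
Qed.

(* Index: the adjoint flag and the sign of the diagonal of each factor. *)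
Definition pair_cov (p q : bool * bool) : R[i] :=
  let b1 := p.1 (+) p.2 in let b2 := q.1 (+) q.2 in
  (cov_xx b1 b2)%:C + imaginary_unit p.1 * (cov_xy b2 b1)%:C +
  (imaginary_unit q.1 * (cov_xy b1 b2)%:C +
   imaginary_unit p.1 * imaginary_unit q.1 * (cov_yy b1 b2)%:C).

Lemma cexpectation_pair n v p q : (0 < v)%N ->
  cexpectation P (fun w => diagonal_entry n p.1 (signed p.2 v) w *
                           diagonal_entry n q.1 (signed q.2 v) w) = pair_cov p q.
Proof.
move=> v0; pose b1 := p.1 (+) p.2; pose b2 := q.1 (+) q.2.
have sE (b : bool * bool) : (if b.1 then - signed b.2 v else signed b.2 v) =
    signed (b.1 (+) b.2) v.
  by case: b => -[] [] /=; rewrite /signed ?opprK.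
pose X b w := (x n (signed b v) w)%:C : R[i].
pose Y b w := (y n (signed b v) w)%:C : R[i].
rewrite (_ : (fun w => _) = fun w =>
  (X b1 w * X b2 w + imaginary_unit p.1 * (X b2 w * Y b1 w)) +
  (imaginary_unit q.1 * (X b1 w * Y b2 w) +
   imaginary_unit p.1 * imaginary_unit q.1 * (Y b1 w * Y b2 w))); last first.
  apply/funext => w; rewrite !diagonal_entryE !sE -/b1 -/b2 -!/(X _ _) -!/(Y _ _).
  ring.
have f b : moments_bounded P (fun _ : unit => X b).
  exact: (moments_bounded_reindex (fun _ => (n, signed b v)) moments_bounded_x).
have g b : moments_bounded P (fun _ : unit => Y b).
  exact: (moments_bounded_reindex (fun _ => (n, signed b v)) moments_bounded_y).
have iXX := moments_bounded_integrable (moments_boundedM (f b1) (f b2)) tt.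
have iXY := moments_bounded_integrable (moments_boundedM (f b1) (g b2)) tt.
have iYX := moments_bounded_integrable (moments_boundedM (f b2) (g b1)) tt.
have iYY := moments_bounded_integrable (moments_boundedM (g b1) (g b2)) tt.
have realM (u z : Om -> R) :
    cexpectation P (fun w => (u w)%:C * (z w)%:C) = (\int[P]_w (u w * z w))%:C.
  rewrite -cexpectation_real; congr cexpectation.
  by apply/funext => w; rewrite -rmorphM.
do 3 (rewrite cexpectationD; last 2 first;
  [by repeat first [exact: cintegrableZ | exact: cintegrableD | assumption
     | apply: cintegrableD]..|]).
rewrite !cexpectationZ// !realM.
by rewrite integral_xx// integral_yy// !integral_xy.
Qed.
End pair_correlation.

(** * Mixed moments of matched entries *)

Section matched_moment.
Context (R : realType) d (Om : measurableType d) (P : probability Om R).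
Variables (x y : nat -> int -> {RV P >-> R}).
Variables (sigmax sigmay rho1 rho2 rho3 rho4 rho5 rho6 : R).
Hypothesis hA :
  pair_correlated x y sigmax sigmay rho1 rho2 rho3 rho4 rho5 rho6.
Variables (S I : finType) (col : S -> I) (star : S -> bool).
Implicit Type h : S -> int.

Definition class_expectation n h (i : I) (v : nat) : R[i] :=
  cexpectation P (fun w => \prod_(s | (col s == i) && (`|h s|%N == v))
    diagonal_entry x y n (star s) (h s) w).

(** The mixed moment of entries on prescribed diagonals [h] of independent
    copies indexed by [I]: entries are independent unless they belong to the
    same copy and to diagonals that are equal or opposite. *)
Definition matched_moment n h : R[i] :=
  \prod_(i : I) \prod_(v < n) class_expectation n h i v.

Lemma class_expectation_empty n h i v :
  (forall s, ~~ ((col s == i) && (`|h s|%N == v))) -> class_expectation n h i v = 1.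
Proof.
move=> e; rewrite /class_expectation.
rewrite (_ : (fun w => _) = fun _ => (1 : R)%:C); last first.
  by apply/funext => w; rewrite big_pred0// => s; exact/negbTE.
rewrite cexpectation_real /Rintegral integral_cst//= probability_setT.
by rewrite mule1.
Qed.

(** At most [#|S|] of the factors are not equal to one, and each of them is
    bounded in terms of the set of letters involved. *)
Lemma matched_moment_bounded :
  exists2 C : R, 0 <= C & forall n h, cabs (matched_moment n h) <= C.
Proof.
have /boolp.choice[B hB] : forall Q : {set S}, exists b : R, forall n h,
    cabs (cexpectation P (fun w => \prod_(s in Q)
      diagonal_entry x y n (star s) (h s) w)) <= b.
  move=> Q.
  have hm s : moments_bounded P (fun (p : nat * (S -> int)) =>
      diagonal_entry x y p.1 (star s) (p.2 s)).
    exact: (moments_bounded_reindex (fun p : nat * (S -> int) => (p.1, p.2 s))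
      (moments_bounded_entry hA (star s))).
  have [C hC] := moments_bounded_expectation
    (moments_bounded_prod (index_enum S) (fun s => s \in Q) hm).
  by exists C => n h; have := hC (n, h).
pose C0 := 1 + \sum_Q `|B Q|.
have C1 : 1 <= C0 by rewrite lerDl sumr_ge0.
have BC Q : B Q <= C0.
  rewrite /C0 (bigD1 Q)//= addrCA; apply: le_trans (ler_norm _) _.
  by rewrite lerDl addr_ge0// sumr_ge0.
exists (C0 ^+ #|S|) => [|n h]; first by rewrite exprn_ge0// (le_trans ler01).
pose k i v := #|[pred s | (col s == i) && (`|h s|%N == v)]|.
have hF i v : cabs (class_expectation n h i v) <= C0 ^+ k i v.
  have [/eqP k0|k0] := posnP (k i v).
    rewrite class_expectation_empty ?cabs1 ?exprn_ege1// => s.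
    by move: k0 => /eqP /card0_eq /(_ s); rewrite inE => ->.
  apply: (@le_trans _ _ C0); last by rewrite -[leLHS]expr1 ler_weXn2l.
  apply: le_trans (BC [set s | (col s == i) && (`|h s|%N == v)]%SET).
  apply: le_trans (hB _ n h); rewrite le_eqVlt; apply/orP; left; apply/eqP.
  congr (cabs (cexpectation P _)); apply/funext => w.
  by apply: eq_bigl => s; rewrite inE.
rewrite /matched_moment cabs_prod.
apply: (@le_trans _ _ (\prod_(i : I) \prod_(v < n) C0 ^+ k i v)).
  apply: ler_prod => i _; rewrite cabs_ge0 cabs_prod andTb.
  by apply: ler_prod => v _; apply/andP; split; [exact: cabs_ge0|exact: hF].
under eq_bigr do rewrite -expr_sum.
rewrite -expr_sum ler_weXn2l//.
have kE i v : k i v = (\sum_s ((col s == i) && (`|h s|%N == v)))%N.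
  by rewrite /k -sum1_card big_mkcond; apply: eq_bigr => s _; rewrite inE; case: ifP.
under eq_bigr do under eq_bigr do rewrite kE.
under eq_bigr do rewrite exchange_big /=.
rewrite exchange_big /= -sum1_card; apply: leq_sum => s _.
rewrite (bigD1 (col s))//= [X in (_ + X)%N]big1 ?addn0; last first.
  by move=> i /negbTE si; rewrite big1// => v _; rewrite eq_sym si.
have [hn|hn] := ltnP `|h s|%N n.
  rewrite (bigD1 (Ordinal hn))//= !eqxx big1// => v; rewrite -val_eqE /= => /negbTE.
  by rewrite eq_sym => ->.
rewrite big1// => v _; rewrite eqxx /=; case: eqP => // e.
by have := ltn_ord v; rewrite -e ltnNge hn.
Qed.

Lemma abs_signed b v : `|signed b v|%N = v.
Proof. by rewrite /signed; case: b; lia. Qed.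

Lemma matched_moment_singleton (neg : {ffun S -> bool}) n (m : {ffun S -> 'I_n}) :
  has_singleton col m -> matched_moment n (fun s => signed (neg s) (m s)) = 0.
Proof.
move=> [s hs]; rewrite /matched_moment (bigD1 (col s))//= (bigD1 (m s))//=.
suff -> : class_expectation n (fun s => signed (neg s) (m s)) (col s) (m s) = 0.
  by rewrite !mul0r.
rewrite -(cexpectation_entry hA n (star s) (signed (neg s) (m s))).
congr cexpectation; apply/funext => w; apply: big_pred1 => t.
rewrite abs_signed /=; apply/andP/eqP => [[/eqP ct /eqP mt]|->]; last by rewrite !eqxx.
by apply: hs; rewrite /cls ct mt.
Qed.

Definition partner (c : {ffun S -> S}) (r : S) : S :=
  odflt r [pick t | (c t == r) && (t != r)].

(** On a pairing, each class contributes the covariance of its two elements,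
    which depends on the signs of the diagonals only. *)
Lemma matched_moment_pairing (neg : {ffun S -> bool}) :
  exists kappa : {ffun S -> S} -> R[i],
  forall n (m : {ffun S -> 'I_n}), (0 < n)%N -> (forall s, 0 < m s)%N ->
    (forall s, #|[pred t | class_rep (cls col m) t == class_rep (cls col m) s]| = 2) ->
    matched_moment n (fun s => signed (neg s) (m s)) = kappa (class_rep (cls col m)).
Proof.
pose cov := pair_cov sigmax sigmay rho1 rho2 rho3 rho4 rho5 rho6.
exists (fun c : {ffun S -> S} => \prod_(r | c r == r)
  cov (star r, neg r) (star (partner c r), neg (partner c r))) => n m n0 m0.
set c := class_rep (cls col m) => f2.
have idem : forall s, c (c s) = c s by apply: class_rep_idem; exact: class_repK.
pose h s := signed (neg s) (m s); rewrite -/h.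
pose key (s : S) : I * 'I_n := (col s, m s).
have keyE s t : (c s == c t) = (key s == key t).
  by rewrite /c class_rep_eq /cls /key !xpair_eqE val_eqE.
rewrite /matched_moment pair_bigA /= [RHS](partition_big key xpredT)//=.
apply: eq_bigr => -[i v] _ /=.
have [s /eqP sE|none] := pickP [pred s | key s == (i, v)]; last first.
  rewrite class_expectation_empty ?big_pred0// => s; have := none s => /= e.
    by rewrite e andbF.
  by rewrite /h abs_signed; move: e; rewrite /key xpair_eqE val_eqE => ->.
have csE r : (c r == r) && (key r == (i, v)) = (r == c s).
  rewrite -sE -keyE; apply/andP/eqP => [[/eqP <- /eqP <-]//|->].
  by rewrite !idem.
rewrite (big_pred1 _ csE); set r := c s.
have rr : c r = r by rewrite /r idem.
have : #|[pred t | c t == r]| = 2 by rewrite -rr.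
rewrite (cardD1 r) inE rr eqxx => -[] /mem_card1[t ht].
have /andP[tr ct] : (t != r) && (c t == r).
  by have := ht t; rewrite !inE eqxx.
have -> : partner c r = t.
  rewrite /partner; case: pickP => [t' /andP[ct' tr']|/(_ t)]; last by rewrite ct tr.
  by have := ht t'; rewrite !inE ct' tr' => /esym/eqP.
rewrite /class_expectation.
have mrt : m r = m t.
  by have := keyE r t; rewrite rr (eqP ct) eqxx => /esym/eqP[_ ->].
rewrite /cov -(cexpectation_pair hA n (star r, neg r) (star t, neg t) (m0 r)).
congr cexpectation; apply/funext => w.
have memE u : (col u == i) && (`|h u|%N == v) = (c u == r).
  rewrite /h abs_signed -[RHS]/(c u == c s) keyE sE /key xpair_eqE.
  by rewrite val_eqE.
rewrite (eq_bigl _ _ memE) (bigD1 r) ?rr//=; congr (_ * _).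
rewrite (big_pred1 t) ?mrt// => u.
by have := ht u; rewrite !inE andbC.
Qed.
End matched_moment.

(** * Independent copies of the Toeplitz matrix *)

Section copies.
Context (R : realType) d (Om : measurableType d) (P : probability Om R).
Variables (x y : nat -> int -> {RV P >-> R}).
Variables (sigmax sigmay rho1 rho2 rho3 rho4 rho5 rho6 : R).
Hypothesis hA :
  pair_correlated x y sigmax sigmay rho1 rho2 rho3 rho4 rho5 rho6.

(** The independent blocks of one Toeplitz matrix. *)
Definition input_block n (j : nat) (w : Om) :=
  (x n j%:Z w, x n (- j%:Z) w, y n j%:Z w, y n (- j%:Z) w).

Definition block_coord (neg : bool) (t : R * R * R * R) : R[i] :=
  if neg then t.1.1.2 +i* t.2 else t.1.1.1 +i* t.1.2.

Lemma inputE n h w : input x y n h w = block_coord (h < 0) (input_block n `|h|%N w).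
Proof. by case: h => p; rewrite /input /block_coord //= NegzE. Qed.

Lemma cmeasurable_starc d' (T : measurableType d') star (Z : T -> R[i]) :
  cmeasurable Z -> cmeasurable (fun t => starc star (Z t)).
Proof.
case: star => // -[a b]; split.
  by rewrite (_ : (fun t => _) = fun t => complex.Re (Z t))//; apply/funext => t;
     case: (Z t).
rewrite (_ : (fun t => _) = \- (fun t => complex.Im (Z t))); first exact: measurable_funN.
by apply/funext => t /=; case: (Z t).
Qed.

Lemma cmeasurable_block_coord neg : cmeasurable (block_coord neg).
Proof.
have m1 : measurable_fun setT (fun t : R * R * R * R => t.1) by exact: measurable_fst.
have m11 : measurable_fun setT (fun t : R * R * R * R => t.1.1).
  exact: (measurableT_comp measurable_fst m1).
case: neg; split => /=.
- exact: (measurableT_comp measurable_snd m11).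
- exact: measurable_snd.
- exact: (measurableT_comp measurable_fst m11).
- exact: (measurableT_comp measurable_snd m1).
Qed.

Lemma measurable_input_block n j : measurable_fun setT (input_block n j).
Proof.
rewrite /input_block; do 3 (apply: measurable_fun_pair; last exact: measurable_funP).
exact: measurable_funP.
Qed.

Section entries.
Variables (S I : finType) (col : S -> I) (star : S -> bool).

Let entry n (h : S -> int) s w := diagonal_entry x y n (star s) (h s) w.

Lemma cintegrable_entries n h (Q : pred S) :
  cintegrable P (fun w => \prod_(s | Q s) entry n h s w).
Proof.
have hm s : moments_bounded P (fun _ : unit => entry n h s).
  exact: (moments_bounded_reindex (fun _ => (n, h s)) (moments_bounded_entry hA (star s))).
exact: (moments_bounded_integrable (moments_bounded_prod (index_enum S) Q hm) tt).
Qed.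

Lemma cexpectation_one_copy n h i : (forall s, `|h s| < n)%N ->
  cexpectation P (fun w => \prod_(s | col s == i) entry n h s w) =
  \prod_(v < n) class_expectation x y col star n h i v.
Proof.
move=> hn.
pose F (v : 'I_n) (t : R * R * R * R) : R[i] :=
  \prod_(s | (col s == i) && (`|h s|%N == v))
    starc (star s) (block_coord ((if star s then - h s else h s) < 0) t).
have FE v w : F v (input_block n v w) =
    \prod_(s | (col s == i) && (`|h s|%N == v)) entry n h s w.
  apply: eq_bigr => s /andP[_ /eqP sv]; rewrite /entry /diagonal_entry inputE.
  by congr (starc _ (block_coord _ (input_block _ _ _))); case: (star s); rewrite ?abszN.
have prodE w : \prod_(s | col s == i) entry n h s w = \prod_v F v (input_block n v w).
  rewrite (partition_big (fun s => Ordinal (hn s)) xpredT)//=.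
  by apply: eq_bigr => v _; rewrite FE.
have ind : independent_family P (fun (v : 'I_n) => input_block n v).
  exact: (mutually_independent_family val_inj (pc_indep hA n)).
have [] := cexpectation_prod (fun v : 'I_n => measurable_input_block n v) ind (f := F).
- move=> v; apply: cmeasurable_prod => s; apply: cmeasurable_starc.
  exact: cmeasurable_block_coord.
- by move=> v; under boolp.eq_fun do rewrite FE; exact: cintegrable_entries.
move=> _; under [X in cexpectation P X = _ -> _]boolp.eq_fun do rewrite -prodE.
move=> ->; apply: eq_bigr => v _; congr cexpectation.
by apply/funext => w; rewrite FE.
Qed.

Definition mxcoord_entry n (t : n.-tuple (n.-tuple (R * R)%type)) (k l : 'I_n) : R[i] :=
  (tnth (tnth t k) l).1 +i* (tnth (tnth t k) l).2.

Lemma mxcoordK n (M : 'M[R[i]]_n) k l : mxcoord_entry (mxcoord M) k l = M k l.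
Proof. by rewrite /mxcoord_entry !tnth_mktuple /=; case: (M k l). Qed.

Lemma cmeasurable_mxcoord_entry n (k l : 'I_n) :
  cmeasurable (fun t => @mxcoord_entry n t k l).
Proof.
have m : measurable_fun setT
    (fun t : n.-tuple (n.-tuple (R * R)%type) => tnth (tnth t k) l).
  exact: (measurableT_comp (measurable_tnth l) (measurable_tnth k)).
split; first exact: (measurableT_comp measurable_fst m).
exact: (measurableT_comp measurable_snd m).
Qed.

Lemma random_matrix_scaled_toeplitz n : random_matrix (scaled_toeplitz x y n).
Proof.
apply/measurable_fun_tnthP => k; apply/measurable_fun_tnthP => l.
pose h := (k : nat)%:Z - (l : nat)%:Z.
rewrite (_ : _ \o _ = fun w => ((Num.sqrt n%:R)^-1 * x n h w, (Num.sqrt n%:R)^-1 * y n h w)).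
  by apply: measurable_fun_pair; apply: measurable_funM => //; exact: measurable_funP.
apply/funext => w /=; rewrite !tnth_mktuple !mxE /=; congr (_, _); ring.
Qed.

Lemma starpow_entry n (b : bool) (M : 'M[R[i]]_n) k l :
  starpow b M k l = starc b (M (if b then l else k) (if b then k else l)).
Proof. by case: b; rewrite //= !mxE. Qed.

Lemma scaled_toeplitz_entry n b k l w :
  starpow b (scaled_toeplitz x y n w) k l =
  (Num.sqrt n%:R)^-1%:C * diagonal_entry x y n b ((k : nat)%:Z - (l : nat)%:Z) w.
Proof.
rewrite starpow_entry /diagonal_entry /starc; case: b; rewrite !mxE ?opprB//.
by rewrite rmorphM /=; congr (_ * _); apply/eqP; rewrite eq_complex /= oppr0 !eqxx.
Qed.

(** The expectation factors over the copies by independence; each copy may be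
    replaced by the Toeplitz matrix since both have the same law; and the
    expectation for one Toeplitz matrix factors over its blocks. *)
Lemma copies_moment n (A : I -> Om -> 'M[R[i]]_n) (k l : S -> 'I_n) : (0 < n)%N ->
  independent_copies P A (scaled_toeplitz x y n) ->
  cintegrable P (fun w => \prod_s starpow (star s) (A (col s) w) (k s) (l s)) /\
  cexpectation P (fun w => \prod_s starpow (star s) (A (col s) w) (k s) (l s)) =
    (Num.sqrt n%:R)^-1%:C ^+ #|S| *
    matched_moment x y col star n (fun s => (k s : nat)%:Z - (l s : nat)%:Z).
Proof.
move=> n0 [mA indA lawA].
pose h s := (k s : nat)%:Z - (l s : nat)%:Z.
have hn s : (`|h s| < n)%N.
  by rewrite /h; have := ltn_ord (k s); have := ltn_ord (l s); lia.
pose q : R[i] := (Num.sqrt n%:R)^-1%:C.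
pose f i t : R[i] := \prod_(s | col s == i) starc (star s)
  (@mxcoord_entry n t (if star s then l s else k s) (if star s then k s else l s)).
have mf i : cmeasurable (f i).
  by apply: cmeasurable_prod => s; apply: cmeasurable_starc; exact: cmeasurable_mxcoord_entry.
have fE i M : f i (mxcoord M) = \prod_(s | col s == i) starpow (star s) M (k s) (l s).
  by apply: eq_bigr => s _; rewrite mxcoordK starpow_entry.
have fX i w : f i (mxcoord (scaled_toeplitz x y n w)) =
    (\prod_(s | col s == i) q) * \prod_(s | col s == i) entry n h s w.
  rewrite fE -big_split; apply: eq_bigr => s _; exact: scaled_toeplitz_entry.
have intX i : cintegrable P (fun w => f i (mxcoord (scaled_toeplitz x y n w))).
  by under boolp.eq_fun do rewrite fX; apply: cintegrableZ; exact: cintegrable_entries.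
have law i := identically_distributed_cexpectation (mA i)
  (@random_matrix_scaled_toeplitz n) (lawA i) (mf i) (intX i).
have indA' : independent_family P (fun i w => mxcoord (A i w)).
  exact: (mutually_independent_family (e := id) (fun _ _ => id) indA).
have prodE w : \prod_i f i (mxcoord (A i w)) =
    \prod_s starpow (star s) (A (col s) w) (k s) (l s).
  rewrite [RHS](partition_big col xpredT)//=; apply: eq_bigr => i _.
  by rewrite fE; apply: eq_bigr => s /eqP ->.
have [] := cexpectation_prod mA indA' mf (fun i => (law i).1).
under boolp.eq_fun do rewrite prodE.
move=> h1 ->; split=> //.
under eq_bigr do rewrite (law _).2.
rewrite /matched_moment -/q.
have -> : q ^+ #|S| = \prod_i \prod_(s | col s == i) q.
  by rewrite -prodr_const (partition_big col xpredT).
rewrite -big_split; apply: eq_bigr => i _ /=.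
under boolp.eq_fun do rewrite fX.
by rewrite cexpectationZ ?cexpectation_one_copy//; exact: cintegrable_entries.
Qed.
End entries.
End copies.

(** * Trace expansion and convergence *)

Section trace_expansion.
Variable R : comNzRingType.

Lemma entry_prod K n (M : nat -> 'M[R]_n) (a b : 'I_n) :
  (\prod_(j < K) M j) a b =
  \sum_(k : {ffun 'I_K.+1 -> 'I_n} | (k ord0 == a) && (k ord_max == b))
    \prod_(j < K) M j (k (inord j)) (k (inord j.+1)).
Proof.
elim: K a b => [|K IH] a b.
  rewrite big_ord0 mxE; pose k0 : {ffun 'I_1 -> 'I_n} := [ffun=> a].
  under eq_bigr do rewrite big_ord0.
  have [<-|ab] := eqVneq a b.
    rewrite (big_pred1 k0) // => k.
    have -> : (ord_max : 'I_1) = ord0 by exact: val_inj.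
    rewrite andbb; apply/eqP/eqP => [ka|->]; last by rewrite ffunE.
    by apply/ffunP => j; rewrite ffunE (ord1 j).
  rewrite big_pred0// => k; have -> : (ord_max : 'I_1) = ord0 by exact: val_inj.
  by apply/negP => /andP[/eqP -> /eqP e]; rewrite e eqxx in ab.
rewrite big_ord_recr /= mxE.
pose ext (p : {ffun 'I_K.+1 -> 'I_n}) : {ffun 'I_K.+2 -> 'I_n} :=
  [ffun j : 'I_K.+2 => if (j < K.+1)%N then p (inord j) else b].
pose res (k : {ffun 'I_K.+2 -> 'I_n}) : {ffun 'I_K.+1 -> 'I_n} :=
  [ffun j : 'I_K.+1 => k (inord j)].
have extE p j : (j < K.+1)%N -> ext p (inord j) = p (inord j).
  by move=> jK; rewrite ffunE inordK ?jK// ltnW.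
have ext0 p : ext p ord0 = p ord0.
  by rewrite ffunE /=; congr (p _); apply: val_inj; rewrite /= inordK.
have extmax p : ext p ord_max = b by rewrite ffunE ltnn.
rewrite [RHS](reindex_onto ext res) /=; last first.
  move=> k /andP[_ /eqP kb]; apply/ffunP => j; rewrite ffunE.
  case: ifPn => jK; first by rewrite ffunE inordK// inord_val.
  rewrite -kb; congr (k _); apply: val_inj => /=.
  by have := ltn_ord j; lia.
have resK p : res (ext p) = p.
  by apply/ffunP => j; rewrite ffunE extE// inord_val.
under eq_bigr do rewrite IH mulr_suml.
rewrite (exchange_big_dep (fun p : {ffun 'I_K.+1 -> 'I_n} => p ord0 == a)) /=; last first.
  by move=> c p _ /andP[].
apply: eq_big => [p|p /eqP pa].
  by rewrite ext0 extmax resK !eqxx !andbT.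
rewrite (big_pred1 (p ord_max)); last by move=> c; rewrite pa eqxx /= eq_sym.
rewrite [RHS]big_ord_recr /=; congr (_ * _).
  apply: eq_bigr => j _; have jK := ltn_ord j.
  by rewrite (extE p j (ltnW jK)) (extE p j.+1 jK).
have e1 : (inord K : 'I_K.+1) = ord_max by apply: val_inj; rewrite /= inordK.
have e2 : (inord K.+1 : 'I_K.+2) = ord_max by apply: val_inj; rewrite /= inordK.
by rewrite extE// e1 e2 extmax.
Qed.

Lemma trace_prod K n (M : nat -> 'M[R]_n) :
  \tr (\prod_(j < K) M j) =
  \sum_(k : {ffun 'I_K.+1 -> 'I_n} | k ord0 == k ord_max)
    \prod_(j < K) M j (k (inord j)) (k (inord j.+1)).
Proof.
rewrite /mxtrace [RHS](partition_big (fun k : {ffun 'I_K.+1 -> 'I_n} => k ord0) predT)//=.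
apply: eq_bigr => a _; rewrite entry_prod; apply: eq_bigl => k.
by rewrite andbC; have [->|] := eqVneq (k ord0) a; rewrite ?andbF ?andbT// eq_sym.
Qed.
End trace_expansion.

Section completeness.
Variable R : realType.

(** The reals are complete, and both coordinates of the sequence are Cauchy. *)
Lemma cauchy_sequence_cvg (u : nat -> R[i]) : cauchy_sequence u ->
  cvgn (u : nat -> R[i]^o).
Proof.
move=> hu.
have real (f : R[i] -> R) : (forall z1 z2, `|f z1 - f z2| <= cabs (z1 - z2)) ->
    cvgn (fun n => f (u n)).
  move=> hf; apply: cauchy_cvg; apply/cauchyP => e e0.
  have e2 : 0 < e / 2 by rewrite divr_gt0.
  have [N hN] := hu _ e2; exists (f (u N)); exists N => // n /= Nn.
  rewrite /ball /= ; apply: le_lt_trans (hf _ _) _.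
  by apply: le_lt_trans (hN _ _ (leqnn N) Nn) _; lra.
have hRe : cvgn (fun n => complex.Re (u n)).
  by apply: (real (fun z => complex.Re z)) => z1 z2; rewrite -raddfB; exact: Re_le_cabs.
have hIm : cvgn (fun n => complex.Im (u n)).
  by apply: (real (fun z => complex.Im z)) => z1 z2; rewrite -raddfB; exact: Im_le_cabs.
pose l := limn (fun n => complex.Re (u n)) +i* limn (fun n => complex.Im (u n)).
apply/cvg_ex; exists l; apply/cvgrPdist_le => e; rewrite ltcE /= => /andP[/eqP e0 e1].
have e2 : 0 < complex.Re e / 2 by rewrite divr_gt0.
have /cvgrPdist_le /(_ _ e2) h1 := hRe; have /cvgrPdist_le /(_ _ e2) h2 := hIm.
near=> n; rewrite cabs_norm lecE /= e0 eqxx /=.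
apply: le_trans (cabs_le_ReIm _) _; rewrite !raddfB /= [leRHS]splitr lerD//.
  by near: n; exact: h1.
by near: n; exact: h2.
Unshelve. all: by end_near. Qed.

Lemma absolutely_summable_by (f : int -> R[i]) :
  absolutely_summable f -> exists D, summable_by f D.
Proof.
rewrite /absolutely_summable => h.
exists (fine (\esum_(k in [set: int]) (cabs (f k))%:E)%E) => r ur.
rewrite -lee_fin fineK; last first.
  rewrite ge0_fin_numE// esum_ge0// => k _; rewrite lee_fin; exact: cabs_ge0.
apply: esum_ge; exists [set` r].
  by split => //; exact: finite_seq.
by rewrite -fsbig_seq// (big_morph EFin EFinD (erefl 0%:E)).
Qed.

Lemma summable_by_point_mass a : summable_by (@point_mass R a) 1.
Proof.
move=> r ur; have [ar|ar] := boolP (a \in r); last first.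
  rewrite big_seq big1 ?ler01// => b br; rewrite /point_mass.
  by case: eqP => [ba|_]; [rewrite -ba br in ar|rewrite cabs0].
rewrite (bigD1_seq a)//= big1 ?addr0; first by rewrite /point_mass eqxx cabs1.
by move=> b /negbTE ba; rewrite /point_mass ba cabs0.
Qed.

Lemma summable_by_adjoint (f : int -> R[i]) D : summable_by f D ->
  summable_by (fun h => Num.conj (f (- h))) D.
Proof.
move=> hf r ur; have := hf [seq - b | b <- r].
rewrite (map_inj_uniq oppr_inj) big_map => /(_ ur).
by under [in X in _ -> X]eq_bigr do rewrite cabs_conj.
Qed.
End completeness.

Section joint_convergence.
Context (R : realType) d (Om : measurableType d) (P : probability Om R).
Variables (x y : nat -> int -> {RV P >-> R}).
Variables (sigmax sigmay rho1 rho2 rho3 rho4 rho5 rho6 : R).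
Hypothesis hA :
  pair_correlated x y sigmax sigmay rho1 rho2 rho3 rho4 rho5 rho6.

Lemma joint_convergence (I : finType) (A : forall n, I -> Om -> 'M[R[i]]_n)
    (dd : I -> int -> R[i]) :
  (forall n, independent_copies P (A n) (scaled_toeplitz x y n)) ->
  (forall i, absolutely_summable (dd i)) ->
  converge_in_star_distribution P
    (fun n => joint_family (A n) (fun i => toeplitz (dd i) n)).
Proof.
move=> hcop hsum [//|K'] letter eps _; set K := K'.+1 in letter eps *.
apply: cauchy_sequence_cvg.
(* Letters are extended to all natural numbers, so that products over an
   initial segment can be split and reindexed. *)
pose lt (j : nat) := letter (inord j); pose st (j : nat) := eps (inord j).
pose flip j := if lt j is inl _ then true else false.
pose rnd j := if lt j is inr (inl _) then true else false.
pose w j h : R[i] := match lt j with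
  | inl _ => point_mass R 0 h
  | inr (inl _) => 1
  | inr (inr c) => if st j then Num.conj (dd c (- h)) else dd c h
  end.
pose S := {s : 'I_K | rnd s}.
have [col hcol] : exists col : S -> I, forall s : S, lt (val s) = inr (inl (col s)).
  have h (s : S) : exists c, lt (val s) = inr (inl c).
    by case: s => s /=; rewrite /rnd; case: (lt s) => [//|[c|//]] _; exists c.
  by have [col hcol] := boolp.choice h; exists col.
pose star (s : S) := st (val s).
pose En n (h : S -> int) := matched_moment x y col star n h.
have [C C0 hC] := matched_moment_bounded hA col star.
have main : cauchy_sequence (@walk_sum R K flip rnd En w).
  refine (@walk_sum_cauchy R K flip rnd I col En C C0 _ _ _ w _).
  - by move=> n h _ _; exact: hC.
  - by move=> neg n m; exact: (matched_moment_singleton hA).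
  - by move=> neg; exact: (matched_moment_pairing hA col star neg).
  move=> j _; rewrite /rnd /w; case: (lt j) => [_ _|[//|c] _].
    by exists 1; exact: summable_by_point_mass.
  have [D hD] := absolutely_summable_by (hsum c); exists D.
  by case: (st j) => //; exact: summable_by_adjoint.
apply: eq_cauchy main => n n0.
pose M (wd : Om) (j : nat) : 'M[R[i]]_n :=
  starpow (st j) (joint_family (A n) (fun i => toeplitz (dd i) n) (lt j) wd).
have detE wd j (k : {ffun 'I_K.+1 -> 'I_n}) : ~~ rnd j ->
    M wd j (k (inord j)) (k (inord j.+1)) = w j (offset flip k j).
  rewrite /rnd /M /w /offset /flip starpow_entry.
  case: (lt j) => [_ _|[//|c] _] /=; last first.
    by case: (st j); rewrite /starc !mxE ?opprB.
  rewrite /starc /point_mass; case: (st j); rewrite !mxE ?rmorph_nat.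
    by congr ((nat_of_bool _)%:R); apply/eqP/eqP; lia.
  by congr ((nat_of_bool _)%:R); apply/eqP/eqP; lia.
pose Z (k : {ffun 'I_K.+1 -> 'I_n}) wd := \prod_(s : S)
  starpow (star s) (A n (col s) wd) (k (inord (val s))) (k (inord (val s).+1)).
have termE wd (k : {ffun 'I_K.+1 -> 'I_n}) :
  \prod_(j < K) M wd j (k (inord j)) (k (inord j.+1)) =
    (\prod_(j < K | ~~ rnd j) w j (offset flip k j)) * Z k wd.
  rewrite (bigID (fun j : 'I_K => rnd j)) /= mulrC; congr (_ * _).
    by apply: eq_bigr => j; exact: detE.
  rewrite (reindex_omap (val : S -> 'I_K) insub) /=; last first.
    by move=> j rj; rewrite insubT.
  apply: eq_big => [s|s _]; first by rewrite (valP s) valK eqxx.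
  by rewrite /M hcol.
have hZ (k : {ffun 'I_K.+1 -> 'I_n}) := copies_moment hA col star
  (fun s : S => k (inord (val s))) (fun s : S => k (inord (val s).+1)) n0 (hcop n).
rewrite /phi.
have -> : (fun wd => \tr (\prod_(s < K) starpow (eps s)
    (joint_family (A n) (fun i => toeplitz (dd i) n) (letter s) wd))) =
  fun wd => \sum_(k : {ffun 'I_K.+1 -> 'I_n} | k ord0 == k ord_max)
    (\prod_(j < K | ~~ rnd j) w j (offset flip k j)) * Z k wd.
  apply/funext => wd.
  rewrite (eq_bigr (fun s : 'I_K => M wd s)); last first.
    by move=> s _; rewrite /M /st /lt inord_val.
  by rewrite trace_prod; apply: eq_bigr => k _; rewrite termE.
rewrite cexpectation_sum; last first.
  by move=> k _; apply: cintegrableZ; case: (hZ k).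
rewrite /walk_sum /scaling -mulrA; congr (_ * _); rewrite mulr_sumr.
apply: eq_bigr => k _; rewrite cexpectationZ; last by case: (hZ k).
rewrite (hZ k).2 mulrCA; congr (_ * (_ * _)).
congr (matched_moment x y col star n _); apply/funext => s.
rewrite /offset /flip; have := valP s; rewrite /rnd.
by case: (lt (val s)) => [//|[]].
Qed.
End joint_convergence.

(** The family that consists of the Toeplitz matrix alone is a family of
    independent copies of it, so the second claim is an instance of the first. *)
Lemma single_copy (R : realType) d (Om : measurableType d) (P : probability Om R)
    (x y : nat -> int -> {RV P >-> R}) n :
  independent_copies P (fun _ : unit => scaled_toeplitz x y n)
    (scaled_toeplitz x y n).
Proof.
split=> //.
- by move=> _; exact: random_matrix_scaled_toeplitz.
- move=> J B mB; have [->|[]] := fset_0Vmem J.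
    rewrite big_seq_fset0 (_ : \bigcap_(i in _) _ = setT) ?probability_setT//.
    by apply/seteqP; split => // w _ i /=; rewrite inE.
  move=> [] tJ; have -> : J = [fset tt]%fset.
    by apply/fsetP => -[]; rewrite tJ in_fset1 eqxx.
  rewrite big_seq_fset1; congr (P _).
  apply/seteqP; split => w /= h; first by apply: (h tt) => /=; rewrite in_fset1.
  by case => _.
Qed.

Theorem theorem1 (R : realType) (disp : measure_display)
    (Omega : measurableType disp) (P : probability Omega R)
    (x y : nat -> int -> {RV P >-> R})
    (sigmax sigmay rho1 rho2 rho3 rho4 rho5 rho6 : R)
    (hA : pair_correlated x y sigmax sigmay rho1 rho2 rho3 rho4 rho5 rho6) :
  (forall (m : nat) (A : forall n, 'I_m -> Omega -> 'M[R[i]]_n)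
      (d : 'I_m -> int -> R[i]),
    (0 < m)%N ->
    (forall n, independent_copies P (A n) (scaled_toeplitz x y n)) ->
    (forall i, absolutely_summable (d i)) ->
    converge_in_star_distribution P
      (fun n => joint_family (A n) (fun i => toeplitz (d i) n)))
  /\
  (forall d : int -> R[i], absolutely_summable d ->
    converge_in_star_distribution P
      (fun n => joint_family (fun _ : unit => scaled_toeplitz x y n)
                             (fun _ : unit => toeplitz d n))).
Proof.
split=> [m A d _ hcop hd|d hd]; first exact: (joint_convergence hA).
exact: (joint_convergence hA (fun n => single_copy x y n) (fun _ : unit => hd)).
Qed.
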